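(* Suppose $\Omega \subset \mathbb{P}(\mathbb{R}^d)$ is a properly convex domain, $\Gamma \leq \mathrm{Aut}(\Omega)$ is convex co-compact, $A \leq \Gamma$ is an infinite Abelian subgroup, and $Z_\Gamma(A)$ is the centralizer of $A$ in $\Gamma$. If $$V := \mathrm{Span}\left\{ v \in \mathbb{R}^d\setminus\{0\} : [v] \in \overline{\mathcal{C}_\Omega(\Gamma)} \text{ and } a[v]=[v] \text{ for all } a \in A\right\},$$ then $\Omega \cap \mathbb{P}(V)$ is a non-empty $Z_\Gamma(A)$-invariant properly convex domain in $\mathbb{P}(V)$ and the quotient $Z_\Gamma(A) \backslash (\Omega \cap \mathbb{P}(V))$ is compact.
   Context: A properly convex domain is an open subset $\Omega \subset \mathbb{P}(\mathbb{R}^d)$ which is a bounded convex subset of some affine chart (similarly in $\mathbb{P}(V)$ for a linear subspace $V$); $\mathrm{Aut}(\Omega) := \{ g \in \mathrm{PGL}_d(\mathbb{R}) : g\Omega = \Omega\}$. For a subgroup $\Gamma \leq \mathrm{Aut}(\Omega)$, the full orbital limit set $\mathcal{L}_\Omega(\Gamma)$ is the set of all $x \in \partial\Omega$ for which there exist $p \in \Omega$ and a sequence $(g_n)$ in $\Gamma$ with $g_n(p) \to x$. $\mathcal{C}_\Omega(\Gamma)$ is the convex hull of $\mathcal{L}_\Omega(\Gamma)$ in $\Omega$ (the convex hull in $\overline{\Omega}$, intersected with $\Omega$). An infinite discrete subgroup $\Gamma \leq \mathrm{Aut}(\Omega)$ is convex co-compact if $\mathcal{C}_\Omega(\Gamma)$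 is non-empty and $\Gamma$ acts co-compactly on $\mathcal{C}_\Omega(\Gamma)$. For $v \in \mathbb{R}^d\setminus\{0\}$, $[v]$ denotes its image in $\mathbb{P}(\mathbb{R}^d)$. *)

(* Defs.v *)
From HB Require Import structures.
From mathcomp Require Import all_boot all_order all_algebra generic_quotient.
From mathcomp Require Import all_classical all_reals all_analysis.
Import Order.TTheory GRing.Theory Num.Theory.
Import numFieldNormedType.Exports.

Set Implicit Arguments.
Unset Strict Implicit.
Unset Printing Implicit Defensive.

Local Open Scope classical_set_scope.
Local Open Scope ring_scope.
Local Open Scope quotient_scope.

Section ProjectiveSpace.
Variables (R : realType) (d : nat).

Definition nzvec : Type := set_type [set v : 'cV[R]_d | v != 0].
HB.instance Definition _ := SubChoice.on nzvec.
HB.instance Definition _ := Topological.on nzvec.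

Lemma nzvec_neq0 (v : nzvec) : val v != 0.
Proof. by have := valP v; rewrite inE. Qed.

Definition collinear (v w : nzvec) : bool :=
  `[< exists2 c : R, c != 0 & val w = c *: val v >].

Lemma collinear_equiv : equiv_class_of collinear.
Proof.
split=> [v|v w|v u w].
- by apply/asboolP; exists 1; rewrite ?oner_eq0 ?scale1r.
- apply/asboolP/asboolP => -[c c0 e]; exists c^-1; rewrite ?invr_eq0 //;
    by rewrite e scalerA mulVf // scale1r.
- move=> /asboolP[c c0 e1] /asboolP[c' c0' e2]; apply/asboolP.
  by exists (c' * c); rewrite ?mulf_neq0 // e2 e1 scalerA.
Qed.

Canonical collinear_equivRel := EquivRelPack collinear_equiv.

(* The real projective space P(R^d), with the quotient topology.
   The class [v] of v : nzvec is \pi_projspace v. *)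
Definition projspace : Type := quotient_topology {eq_quot collinear}.
HB.instance Definition _ := Quotient.on projspace.
HB.instance Definition _ := Topological.on projspace.

Lemma eq_projP (v w : nzvec) :
  \pi_projspace v = \pi_projspace w <->
  exists2 c : R, c != 0 & val w = c *: val v.
Proof.
split; first by move=> /eqmodP /asboolP.
by move=> h; apply/eqmodP/asboolP.
Qed.

Definition GL : Type := set_type [set M : 'M[R]_d | M \in unitmx].
HB.instance Definition _ := SubChoice.on GL.
HB.instance Definition _ := Topological.on GL.

Lemma GL_unit (M : GL) : val M \in unitmx.
Proof. by have := valP M; rewrite inE. Qed.

Definition mkGL (M : 'M[R]_d) (h : M \in unitmx) : GL :=
  exist _ M (mem_set (h : [set M : 'M[R]_d | M \in unitmx] M)).

Definition homothetic (M N : GL) : bool :=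
  `[< exists2 c : R, c != 0 & val N = c *: val M >].

Lemma homothetic_equiv : equiv_class_of homothetic.
Proof.
split=> [v|v w|v u w].
- by apply/asboolP; exists 1; rewrite ?oner_eq0 ?scale1r.
- apply/asboolP/asboolP => -[c c0 e]; exists c^-1; rewrite ?invr_eq0 //;
    by rewrite e scalerA mulVf // scale1r.
- move=> /asboolP[c c0 e1] /asboolP[c' c0' e2]; apply/asboolP.
  by exists (c' * c); rewrite ?mulf_neq0 // e2 e1 scalerA.
Qed.

Canonical homothetic_equivRel := EquivRelPack homothetic_equiv.

(* GL and PGL carry the subspace topology of the matrices and its quotient. *)
Definition PGL : Type := quotient_topology {eq_quot homothetic}.
HB.instance Definition _ := Quotient.on PGL.
HB.instance Definition _ := Choice.on PGL.
HB.instance Definition _ := Topological.on PGL.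

Lemma eq_PGLP (M N : GL) :
  \pi_PGL M = \pi_PGL N <-> exists2 c : R, c != 0 & val N = c *: val M.
Proof.
split; first by move=> /eqmodP /asboolP.
by move=> h; apply/eqmodP/asboolP.
Qed.

Lemma repr_PGL (M : GL) :
  exists2 c : R, c != 0 & val (repr (\pi_PGL M)) = c *: val M.
Proof. by apply/eq_PGLP; rewrite reprK. Qed.

Lemma repr_proj (v : nzvec) :
  exists2 c : R, c != 0 & val (repr (\pi_projspace v)) = c *: val v.
Proof. by apply/eq_projP; rewrite reprK. Qed.

Definition GL1 : GL := mkGL (@unitmx1 R d).

Lemma GLM_subproof (M N : GL) : val M *m val N \in unitmx.
Proof. by rewrite unitmx_mul !GL_unit. Qed.
Definition GLM (M N : GL) : GL := mkGL (GLM_subproof M N).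

Lemma GLV_subproof (M : GL) : invmx (val M) \in unitmx.
Proof. by rewrite unitmx_inv GL_unit. Qed.
Definition GLV (M : GL) : GL := mkGL (GLV_subproof M).

Definition PGL1 : PGL := \pi_PGL GL1.
Definition PGLM (g h : PGL) : PGL := \pi_PGL (GLM (repr g) (repr h)).
Definition PGLV (g : PGL) : PGL := \pi_PGL (GLV (repr g)).

Lemma PGLM_pi (M N : GL) : PGLM (\pi_PGL M) (\pi_PGL N) = \pi_PGL (GLM M N).
Proof.
have [c c0 ec] := repr_PGL M; have [e e0 ee] := repr_PGL N.
apply/esym/eq_PGLP; exists (c * e); first by rewrite mulf_neq0.
by rewrite /= ec ee -scalemxAl -scalemxAr scalerA.
Qed.

Lemma PGLV_pi (M : GL) : PGLV (\pi_PGL M) = \pi_PGL (GLV M).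
Proof.
have [c c0 ec] := repr_PGL M.
apply/esym/eq_PGLP; exists c^-1; first by rewrite invr_eq0.
rewrite /= ec invmxZ //.
by rewrite unitmxZ ?unitfE //; exact: GL_unit.
Qed.

Lemma PGLMA : associative PGLM.
Proof.
move=> g h k; rewrite -[g]reprK -[h]reprK -[k]reprK.
move: (repr g) (repr h) (repr k) => M N P.
rewrite (PGLM_pi N P) (PGLM_pi M N) !PGLM_pi.
apply: (congr1 \pi_PGL); by apply: val_inj; rewrite /= mulmxA.
Qed.

Lemma PGL1M : left_id PGL1 PGLM.
Proof.
move=> g; rewrite -[g]reprK PGLM_pi.
apply: (congr1 \pi_PGL); by apply: val_inj; rewrite /= mul1mx.
Qed.

Lemma PGLM1 : right_id PGL1 PGLM.
Proof.
move=> g; rewrite -[g]reprK PGLM_pi.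
apply: (congr1 \pi_PGL); by apply: val_inj; rewrite /= mulmx1.
Qed.

Lemma PGLVM : left_inverse PGL1 PGLV PGLM.
Proof.
move=> g; rewrite -[g]reprK PGLV_pi PGLM_pi.
apply: (congr1 \pi_PGL); by apply: val_inj; rewrite /= mulVmx ?GL_unit.
Qed.

Lemma PGLMV : right_inverse PGL1 PGLV PGLM.
Proof.
move=> g; rewrite -[g]reprK PGLV_pi PGLM_pi.
apply: (congr1 \pi_PGL); by apply: val_inj; rewrite /= mulmxV ?GL_unit.
Qed.

HB.instance Definition _ :=
  isGroup.Build PGL PGLMA PGL1M PGLM1 PGLVM PGLMV.

Lemma GLact_subproof (M : GL) (v : nzvec) :
  [set u : 'cV[R]_d | u != 0] (val M *m val v).
Proof.
apply/negP => /eqP e; have /negP := nzvec_neq0 v; apply.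
by rewrite -[val v](mulKmx (GL_unit M)) e mulmx0.
Qed.
Definition GLact (M : GL) (v : nzvec) : nzvec :=
  exist _ (val M *m val v) (mem_set (GLact_subproof M v)).

Definition pact (g : PGL) (x : projspace) : projspace :=
  \pi_projspace (GLact (repr g) (repr x)).

Lemma pact_pi (M : GL) (v : nzvec) :
  pact (\pi_PGL M) (\pi_projspace v) = \pi_projspace (GLact M v).
Proof.
have [c c0 ec] := repr_PGL M; have [e e0 ee] := repr_proj v.
apply/esym/eq_projP; exists (c * e); first by rewrite mulf_neq0.
by rewrite /= ec ee -scalemxAl -scalemxAr scalerA.
Qed.

Lemma pact1 (x : projspace) : pact 1%g x = x.
Proof.
rewrite -[x]reprK pact_pi.
apply: (congr1 \pi_projspace).
by apply: val_inj; rewrite /= mul1mx.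
Qed.

Lemma pactM (g h : PGL) (x : projspace) : pact (g * h)%g x = pact g (pact h x).
Proof.
rewrite -[x]reprK -[g]reprK -[h]reprK.
move: (repr g) (repr h) (repr x) => M N v.
rewrite (pact_pi N v) (PGLM_pi M N : _ * _ = _)%g !pact_pi.
apply: (congr1 \pi_projspace); by apply: val_inj; rewrite /= mulmxA.
Qed.

End ProjectiveSpace.

Section Groups.
Variable G : groupType.
Implicit Types H K : set G.

Definition is_subgroup H := group_closed (mem H).

Definition is_abelian H := {in H &, forall g h, commute g h}.

Definition centralizer_in H K :=
  [set h | H h /\ forall k, K k -> commute h k].

End Groups.

Section Quotient.
Variables (R : realType) (d : nat).
Variables (H : set (PGL R d)) (X : set (projspace R d)).

(* For a subgroup H, this says y = h x for some h in H; stated through equality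
   of orbits it is an equivalence relation for any set H. *)
Definition same_orbit (x y : X) : bool :=
  `[< [set pact h (val x) | h in H] = [set pact h (val y) | h in H] >].

Lemma same_orbit_equiv : equiv_class_of same_orbit.
Proof.
split=> [x|x y|y x z]; first exact/asboolP.
- by apply/asboolP/asboolP => ->.
- move=> /asboolP e1 /asboolP e2; apply/asboolP; exact: etrans e1 e2.
Qed.

Canonical same_orbit_equivRel := EquivRelPack same_orbit_equiv.

(* H \ X, where X carries the subspace topology. *)
Definition orbit_space : Type := quotient_topology {eq_quot same_orbit}.
HB.instance Definition _ := Topological.on orbit_space.

Definition compact_quotient := compact [set: orbit_space].

End Quotient.

Lemma same_orbitP (R : realType) (d : nat) (H : set (PGL R d))
    (X : set (projspace R d)) (x y : X) : is_subgroup H ->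
  same_orbit H x y <-> exists2 h, H h & pact h (val x) = val y.
Proof.
move=> [H1 HV].
have H1' : H 1%g by move: H1; rewrite !inE.
have HF g h : H g -> H h -> H (g / h)%g.
  by move=> Hg Hh; have := HV g h; rewrite !inE; apply.
have HVV g : H g -> H (g^-1)%g.
  by move=> Hg; have := HF _ _ H1' Hg; rewrite div1g.
have HM g h : H g -> H h -> H (g * h)%g.
  by move=> Hg Hh; have := HF _ _ Hg (HVV _ Hh); rewrite invgK.
split=> [/asboolP e|[h Hh e]].
  have : [set pact h (val y) | h in H] (val y) by exists 1%g; rewrite ?pact1.
  by rewrite -e => -[h Hh <-]; exists h.
apply/asboolP/seteqP; split=> _ [k Hk <-].
  exists (k / h)%g; first exact: HF.
  by rewrite -e -pactM mulgVK.
by exists (k * h)%g; [exact: HM|rewrite pactM e].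
Qed.

Section Span.
Variables (K : fieldType) (vT : vectType K).

Lemma linear_span_exists (S : set vT) : exists U : {vspace vT},
  forall v, v \in U <->
    exists2 s : seq vT, (forall u, u \in s -> S u) & v \in span s.
Proof.
pose P n := `[< exists2 s : seq vT, (forall u, u \in s -> S u) &
                 \dim (span s) = n >].
have exP : exists n, P n.
  by exists 0%N; apply/asboolP; exists [::] => //; rewrite span_nil dimv0.
have ubP n : P n -> (n <= \dim {:vT})%N.
  by move=> /asboolP[s _ <-]; rewrite dimvS ?subvf.
case: (ex_maxnP exP ubP) => n /asboolP[s sS sn] maxn.
exists (span s) => v; split=> [vs|[t tS vt]]; first by exists s.
have sub : (span s <= span (s ++ t))%VS by rewrite span_cat addvSl.
have : (\dim (span (s ++ t)) <= n)%N.
  apply: maxn; apply/asboolP; exists (s ++ t) => // u.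
  by rewrite mem_cat => /orP[/sS|/tS].
rewrite -sn (geq_leqif (dimv_leqif_eq sub)) => /eqP ->.
by rewrite span_cat -[v]add0r memv_add ?mem0v.
Qed.

Definition linear_span (S : set vT) : {vspace vT} :=
  sval (cid (linear_span_exists S)).

Lemma linear_spanP (S : set vT) (v : vT) : v \in linear_span S <->
  exists2 s : seq vT, (forall u, u \in s -> S u) & v \in span s.
Proof. exact: (svalP (cid (linear_span_exists S))). Qed.

End Span.

Section ConvexProjectiveGeometry.
Variables (R : realType) (d : nat).
Implicit Types (X Omega : set (projspace R d)) (V : {vspace 'cV[R]_d}).
Implicit Types (f : {scalar 'cV[R]_d}) (Gamma : set (PGL R d)).

Definition proj_subspace V : set (projspace R d) :=
  [set \pi_(projspace R d) w | w in [set w : nzvec R d | val w \in V]].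

(* For f <> 0, the affine chart of f is {[v] | f v <> 0}, identified with the
   affine hyperplane {v | f v = 1}; chart_image f X is X seen there. *)
Definition in_chart f X :=
  forall w : nzvec R d, X (\pi_(projspace R d) w) -> f (val w) != 0.

Definition chart_image f X : set 'cV[R]_d :=
  [set val w | w in [set w : nzvec R d |
                      X (\pi_(projspace R d) w) /\ f (val w) = 1]].

Definition proj_convex X := exists f, [/\ exists v, f v != 0,
  in_chart f X & convex_set (chart_image f X)].

(* Affine charts of P(V) are given by the functionals on R^d that do not
   vanish identically on V. *)
Definition properly_convex_domain_in V X :=
  (exists2 U : set (projspace R d), open U & X = U `&` proj_subspace V) /\
  exists f, [/\ exists2 v, v \in V & f v != 0, in_chart f X,
    convex_set (chart_image f X) & bounded_set (chart_image f X)].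

Definition properly_convex_domain X := properly_convex_domain_in fullv X.

Definition proj_Aut Omega : set (PGL R d) := [set g | pact g @` Omega = Omega].

Definition boundary X := closure X `\` interior X.

Definition full_orbital_limit_set Omega Gamma : set (projspace R d) :=
  [set x | boundary Omega x /\
    exists2 p, Omega p & exists2 g : nat -> PGL R d,
      (forall n, Gamma (g n)) & pact (g n) p @[n --> \oo] --> x].

(* The smallest convex subset of Y containing X; meant for Y the closure of a
   properly convex domain, where all charts induce the same segments. *)
Definition convex_hull_in (Y X : set (projspace R d)) : set (projspace R d) :=
  \bigcap_(C in [set C | [/\ proj_convex C, X `<=` C & C `<=` Y]]) C.

Definition convex_core Omega Gamma : set (projspace R d) :=
  convex_hull_in (closure Omega) (full_orbital_limit_set Omega Gamma)
    `&` Omega.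

Definition discrete_subset Gamma := forall g, Gamma g -> isolated Gamma g.

Definition convex_cocompact Omega Gamma :=
  [/\ infinite_set Gamma, discrete_subset Gamma,
      convex_core Omega Gamma !=set0 &
      compact_quotient Gamma (convex_core Omega Gamma)].

Definition fixed_span Omega Gamma (A : set (PGL R d)) : {vspace 'cV[R]_d} :=
  linear_span [set val w | w in [set w : nzvec R d |
    closure (convex_core Omega Gamma) (\pi_(projspace R d) w) /\
    forall a, A a -> pact a (\pi_(projspace R d) w) = \pi_(projspace R d) w]].

End ConvexProjectiveGeometry.

(* Main.v *)
Require Import Defs.
From mathcomp Require Import all_boot all_order all_algebra generic_quotient.
From mathcomp Require Import all_classical all_reals all_analysis.
From mathcomp Require Import ring lra.
Import Order.TTheory GRing.Theory Num.Theory.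
Import numFieldNormedType.Exports.

(** Lifting to linear maps.  Let O be the open convex cone over Omega inside
    the half-space f > 0 of an affine chart, K its closure, and write u <= v
    when v - u lies in K.  Let G be the group of the lifts of elements of
    Gamma that preserve O, and C the cone over the convex core.  Lifts in G of
    commuting elements commute up to a scalar, which is positive because O is
    preserved and equal to 1 by comparing determinants.  So A lifts to a
    commuting set of matrices, and V is the span of the common eigenvectors of
    A in the closure of C.

    Cocompact centralizers ([centralizer_cocompact]).  Let a_1, ..., a_r be
    elements of A whose span contains A.  Suppose that the vectors x_i of C
    satisfy alpha_j x_i <= a_j x_i <= beta_j x_i with constants independent of
    i, and move x_i into a compact set by some g_i in G.  The conjugates
    g_i a_j g_i^-1 and their inverses stay bounded, so by discreteness they
    take a single value for almost all i, along an ultrafilter, and the products g_m^-1 g_i centralize A.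
    Hence the centralizer Z of A acts cocompactly on the vectors of C whose
    displacement obeys given bounds.  Expressed with the order of K, such
    bounds define convex cones.

    Degenerations ([degeneration], [degeneration_injective]).  Let h be a sum
    of common eigenvectors of A in the closure of C, and let p be in C.  The
    vectors h + p / n obey common bounds, so there are z_n in Z such that
    z_n^-1 (h + p / n) converges to some k in C.  The z_n then converge to a
    linear map T that commutes with A, and k = y + x with T y = h and T x = 0.
    If moreover h is interior, relatively to the subspace W, to a Z-invariant
    closed cone J that spans W and contains y, then T v in J implies v in J for
    every v in W; in particular T is injective on W.

    V meets Omega ([fixed_span_meets]).  Take for h the sum of a spanning
    family of common eigenvectors, and for J the closure of C intersected with
    V.  If x = 0, then k = y lies in C and in V.  Otherwise the vectors of the
    closure of C killed by T form a nonzero A-invariant closed cone, which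
    contains a common eigenvector of A by a Perron-Frobenius argument
    ([common_eigenvector]); it lies in V although T is injective on V.

    Z acts cocompactly ([eigen_component], [span_displaced]).  Let q be in K
    and V, and let q_chi be its component for a character chi of A.  Take for
    h the sum e of eigenvectors that span the chi-part of V.  For an
    eigenvector b with another character, b <= t k gives T b <= t e, and the
    powers of an element of A that separates the characters force T b = 0.
    Therefore T q_chi = T q lies in K, hence q_chi lies in K.  Since A is
    infinite and Gamma discrete, e is not interior to K, and the core contains
    the faces of its boundary points ([face_in_core]), so q_chi lies in the
    closure of C.  Summing over chi, every q in K and V lies in the closure of
    C, with displacement bounded by the extreme values of the characters, and
    the cocompactness of centralizers applies to all of Omega inside P(V). *)
Set Implicit Arguments.
Unset Strict Implicit.
Unset Printing Implicit Defensive.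

Local Open Scope classical_set_scope.
Local Open Scope ring_scope.

(** * Limits of matrices along ultrafilters *)

Section Ultrafilters.

Lemma ultra_fmap (S T : Type) (h : S -> T) (U : set_system S) :
  UltraFilter U -> UltraFilter (h @ U).
Proof.
move=> UU; split; first exact: fmap_proper_filter.
move=> H HF sUH; apply/seteqP; split=> [B HB|B]; last exact: sUH.
have [//|UnB] := in_ultra_setVsetC (h @^-1` B) UU.
by have /filter_ex[? []] : H (B `&` ~` B) by apply: filterI => //; exact: sUH.
Qed.

Lemma free_ultrafilter : exists2 U : set_system nat, UltraFilter U & \oo `<=` U.
Proof. by have [U [UU sU]] := ultraFilterLemma eventually_filter; exists U. Qed.

End Ultrafilters.

Section MatrixLimits.
Variable R : realType.

Lemma mx_entry_norm m n (M : 'M[R]_(m, n)) i j : `|M i j| <= `|M|.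
Proof.
rewrite [leRHS]/Num.Def.normr /= mx_normrE.
exact: (le_bigmax _ (fun ij : 'I_m * 'I_n => `|M ij.1 ij.2|) (i, j)).
Qed.

Lemma mx_norm_le m n (M : 'M[R]_(m, n)) c :
  0 <= c -> (forall i j, `|M i j| <= c) -> `|M| <= c.
Proof.
move=> c0 Mc; rewrite [leLHS]/Num.Def.normr /= mx_normrE.
by apply: bigmax_le => // -[i j] _; exact: Mc.
Qed.

Lemma cvg_mxP (I : Type) (F : set_system I) {FF : Filter F} m n
    (u : I -> 'M[R]_(m, n)) (l : 'M[R]_(m, n)) :
  u x @[x --> F] --> l <-> forall i j, u x i j @[x --> F] --> l i j.
Proof.
split=> [ul i j|ul].
  by apply: (cvg_comp _ (fun M : 'M[R]_(m, n) => M i j) ul); exact: coord_continuous.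
apply/cvgrPdist_le => /= e e0.
have H : \forall x \near F, forall ij : 'I_m * 'I_n,
    `|l ij.1 ij.2 - u x ij.1 ij.2| <= e.
  by apply: filter_forall => -[i j] /=; exact: ((cvgrPdist_le _ _).1 (ul i j)).
apply: filterS H => x Hx; apply: mx_norm_le; first exact: ltW.
by move=> i j; rewrite !mxE; exact: (Hx (i, j)).
Qed.

Lemma cvg_mulmx (I : Type) (F : set_system I) {FF : Filter F} m n p
    (u : I -> 'M[R]_(m, n)) (v : I -> 'M[R]_(n, p)) (l : 'M[R]_(m, n)) (k : 'M[R]_(n, p)) :
  u x @[x --> F] --> l -> v x @[x --> F] --> k ->
  u x *m v x @[x --> F] --> l *m k.
Proof.
move=> /cvg_mxP ul /cvg_mxP vk; apply/cvg_mxP => i j.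
rewrite mxE; under eq_fun do rewrite mxE.
apply: cvg_big => // [|q _]; last by apply: cvgM; [exact: ul|exact: vk].
exact: add_continuous.
Qed.

(** This takes the place of extracting convergent subsequences: along an
    ultrafilter all bounded families converge at once. *)
Lemma ultra_cvg_bounded (I : Type) (U : set_system I) {UU : UltraFilter U} m n
    (u : I -> 'M[R]_(m, n)) c :
  (\forall x \near U, `|u x| <= c) -> exists l : 'M[R]_(m, n), u x @[x --> U] --> l.
Proof.
move=> uc.
suff [l ul] : exists l : 'I_m -> 'I_n -> R, forall i j,
    u x i j @[x --> U] --> l i j.
  by exists (\matrix_(i, j) l i j); apply/cvg_mxP => i j; rewrite mxE; exact: ul.
suff H i j : exists r : R, u x i j @[x --> U] --> r.
  exists (fun i j => sval (cid (H i j))) => i j; exact: svalP (cid (H i j)).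
have UU' := ultra_fmap (fun x => u x i j) UU.
have := @segment_compact R (- c) c; rewrite compact_ultra => /(_ _ UU').
case=> [|r [_ ur]]; last by exists r.
rewrite /fmap /=; apply: filterS uc => x ux /=.
by rewrite in_itv /= -ler_norml; apply: le_trans ux; exact: mx_entry_norm.
Qed.

Lemma mulmx_norm_le m n p (M : 'M[R]_(m, n)) (N : 'M[R]_(n, p)) :
  `|M *m N| <= n%:R * `|M| * `|N|.
Proof.
apply: mx_norm_le => [|i j]; first by rewrite !mulr_ge0.
rewrite mxE; apply: le_trans (ler_norm_sum _ _ _) _.
apply: (@le_trans _ _ (\sum_(k < n) `|M| * `|N|)).
  by apply: ler_sum => k _; rewrite normrM; apply: ler_pM => //; exact: mx_entry_norm.
by rewrite sumr_const card_ord -mulrA mulr_natl.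
Qed.

Lemma linear_bounded n (g : {scalar 'cV[R]_n}) :
  exists2 c : R, 0 < c & forall v, `|g v| <= c * `|v|.
Proof.
exists (1 + \sum_(i < n) `|g (delta_mx i 0)|).
  by rewrite ltr_pwDl // sumr_ge0.
move=> v; rewrite {1}(matrix_sum_delta v) linear_sum.
under eq_bigr do rewrite big_ord1 linearZ.
rewrite mulrDl mul1r; apply: ler_wpDl => //.
rewrite mulr_suml; apply: le_trans (ler_norm_sum _ _ _) _.
by apply: ler_sum => i _; rewrite normrM mulrC ler_wpM2l // mx_entry_norm.
Qed.

Lemma linear_cvg n (g : {scalar 'cV[R]_n}) (I : Type) (F : set_system I)
    {FF : Filter F} (u : I -> 'cV[R]_n) (l : 'cV[R]_n) :
  u x @[x --> F] --> l -> g (u x) @[x --> F] --> g l.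
Proof.
move=> ul; have [c c0 gc] := linear_bounded g.
apply/cvgrPdist_le => /= e e0.
have /cvgrPdist_le/(_ (e / c)) := ul; rewrite divr_gt0 // => /(_ isT).
apply: filterS => x xe; rewrite -linearB.
by apply: le_trans (gc _) _; rewrite mulrC -ler_pdivlMr.
Qed.

Lemma subspace_cvg n (W : {vspace 'cV[R]_n}) (I : Type) (F : set_system I)
    {FF : ProperFilter F} (u : I -> 'cV[R]_n) (l : 'cV[R]_n) :
  (\forall x \near F, u x \in W) -> u x @[x --> F] --> l -> l \in W.
Proof.
move=> uW ul.
pose P : 'M[R]_n := \matrix_(i, j) (projv W (delta_mx j 0)) i 0.
have PE v : P *m v = projv W v.
  rewrite {2}[v]matrix_sum_delta linear_sum; apply/colP => i.
  rewrite mxE summxE; apply: eq_bigr => j _.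
  by rewrite big_ord1 linearZ !mxE mulrC.
have Pul : P *m u x @[x --> F] --> P *m l by apply: cvg_mulmx => //; exact: cvg_cst.
have Pul' : P *m u x @[x --> F] --> l.
  apply: cvg_trans ul; apply: near_eq_cvg.
  by apply: filterS uW => x xW; rewrite PE projv_id.
by rewrite -(cvg_unique _ Pul Pul') // PE memv_proj.
Qed.

Lemma subspace_closed n (W : {vspace 'cV[R]_n}) : closed [set v | v \in W].
Proof.
rewrite closedE => v vW.
have : closure [set v | v \in W] v.
  by move=> B Bv; apply: contrapT => WB; apply: vW; apply: filterS Bv => x Bx xW; apply: WB; exists x.
rewrite closureEcvg => -[F FF [Fv FW]].
by apply: (@subspace_cvg _ W _ F _ id) => //; apply: FW => x.
Qed.

Lemma mx_lim_unique m n (I : Type) (F : set_system I) {FF : ProperFilter F}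
    (u : I -> 'M[R]_(m, n)) (l k : 'M[R]_(m, n)) :
  u x @[x --> F] --> l -> u x @[x --> F] --> k -> l = k.
Proof. exact: (@cvg_unique _ (@norm_hausdorff _ 'M[R]_(m, n))). Qed.

Lemma lim_const (I : Type) (F : set_system I) {FF : ProperFilter F}
    (u : I -> R) (l r : R) :
  u x @[x --> F] --> l -> (forall x, u x = r) -> l = r.
Proof.
move=> ul ur; apply: (cvg_unique (@norm_hausdorff R R) ul).
by rewrite (_ : u = fun=> r); [exact: cvg_cst|exact/funext].
Qed.

Lemma closed_lim m n (J : set 'M[R]_(m, n)) (I : Type) (F : set_system I)
    {FF : ProperFilter F} (u : I -> 'M[R]_(m, n)) (l : 'M[R]_(m, n)) :
  closed J -> (\forall x \near F, J (u x)) -> u x @[x --> F] --> l -> J l.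
Proof. by move=> Jcl uJ; apply: (@closed_cvg _ _ F _ u J Jcl uJ). Qed.

End MatrixLimits.
Arguments linear_cvg {R n} g {I F FF u l} _.

(** * Convex cones *)

Section Spans.
Variables (K : fieldType) (vT : vectType K).

Lemma spanning_seq (S : set vT) : exists s : seq vT,
  (forall u, u \in s -> S u) /\ forall v, S v -> v \in span s.
Proof.
pose P n := `[< exists2 s : seq vT, (forall u, u \in s -> S u) &
                 \dim (span s) = n >].
have exP : exists n, P n.
  by exists 0%N; apply/asboolP; exists [::] => //; rewrite span_nil dimv0.
have ubP n : P n -> (n <= \dim {:vT})%N.
  by move=> /asboolP[s _ <-]; rewrite dimvS ?subvf.
case: (ex_maxnP exP ubP) => n /asboolP[s sS sn] maxn.
exists s; split=> // v Sv.
have sub : (span s <= span (v :: s))%VS by rewrite span_cons addvSr.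
have : (\dim (span (v :: s)) <= n)%N.
  apply: maxn; apply/asboolP; exists (v :: s) => // u.
  by rewrite inE => /predU1P[->|/sS].
rewrite -sn (geq_leqif (dimv_leqif_eq sub)) => /eqP ->.
by apply: memv_span; rewrite mem_head.
Qed.

End Spans.

Section Cones.
Variables (R : realType) (d : nat).
Local Notation E := 'cV[R]_d.
Implicit Types (J : set E) (g a : 'M[R]_d).

Record convex_cone J : Prop := ConvexCone {
  cone0 : J 0;
  coneD : forall u v, J u -> J v -> J (u + v);
  coneZ : forall t v, 0 <= t -> J v -> J (t *: v)
}.

Definition preserves g J := forall v, J v -> J (g *m v).

Lemma cone_sum J (I : Type) (r : seq I) (P : pred I) (F : I -> E) :
  convex_cone J -> (forall i, P i -> J (F i)) -> J (\sum_(i <- r | P i) F i).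
Proof. by move=> Jc JF; apply: big_ind => //; [exact: cone0|exact: coneD]. Qed.

(** On the span of the family the coordinates are bounded linear forms, so
    subtracting a small vector from the sum, all of whose coefficients are 1,
    leaves nonnegative coefficients: the sum is interior relatively to the
    span. *)
Lemma span_order_unit J m (b : m.-tuple E) : convex_cone J ->
  (forall i, J (tnth b i)) ->
  exists2 r : R, 0 < r &
    forall v, v \in span b -> `|v| <= r -> J (\sum_i tnth b i - v).
Proof.
move=> Jc Jb.
pose c i := sval (cid2 (linear_bounded (coord b i))).
have c0 i : 0 < c i by rewrite /c; case: cid2.
have cP i v : `|coord b i v| <= c i * `|v| by rewrite /c; case: cid2 => ? ? /=.
pose C := 1 + \sum_i c i.
have C0 : 0 < C by rewrite ltr_pwDl // sumr_ge0 // => i _; exact: ltW.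
exists C^-1; first by rewrite invr_gt0.
move=> v vb vC; rewrite {1}(coord_span vb) -sumrB; apply: cone_sum => // i _.
rewrite -tnth_nth -{1}[tnth b i]scale1r -scalerBl; apply: coneZ => //.
rewrite subr_ge0; apply: le_trans (ler_norm _) _; apply: le_trans (cP _ _) _.
rewrite -(mulVf (lt0r_neq0 C0)) mulrC; apply: ler_pM => //; first exact: ltW.
rewrite /C (bigD1 i) //= addrCA lerDl addr_ge0 ?sumr_ge0 // => j _.
exact: ltW.
Qed.

Lemma closureP J v :
  closure J v <-> forall e, 0 < e -> exists2 u, J u & `|v - u| <= e.
Proof.
split=> [Kv e e0|H B Bv].
  have [u [Ju vu]] := Kv _ (nbhsx_ballx v e e0).
  by exists u => //; rewrite -ball_normE in vu; exact: ltW.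
have /nbhs_closedballP[e eB] := Bv.
have [u Ju vu] := H e%:num (ltac:(done)).
by exists u; split=> //; apply: eB; rewrite closed_ballE.
Qed.

Lemma closure_cone J : J !=set0 -> (forall u v, J u -> J v -> J (u + v)) ->
  (forall t v, 0 < t -> J v -> J (t *: v)) -> convex_cone (closure J).
Proof.
move=> [ o Jo] JD JZ.
have cl0 : closure J 0.
  apply/closureP => e e0.
  exists ((e / (1 + `|o|)) *: o); first by apply: JZ; rewrite // divr_gt0 // ltr_pwDl.
  rewrite sub0r normrN normrZ gtr0_norm ?divr_gt0 ?ltr_pwDl //.
  by rewrite mulrAC ler_pdivrMr ?ltr_pwDl // ler_pM2l // lerDr.
split=> [|u v /closureP Ju /closureP Jv|t v]; first exact: cl0.
  apply/closureP => e e0; have e20 : 0 < e / 2 by rewrite divr_gt0.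
  have [u' Ju' uu] := Ju _ e20; have [v' Jv' vv] := Jv _ e20.
  exists (u' + v'); first exact: JD.
  by rewrite opprD addrACA (splitr e) (le_trans (ler_normD _ _)) // lerD.
rewrite le_eqVlt => /predU1P[<- _|t0]; first by rewrite scale0r.
move=> /closureP Jv; apply/closureP => e e0.
have [|u Ju vu] := Jv (e / t); first by rewrite divr_gt0.
exists (t *: u); first exact: JZ.
by rewrite -scalerBr normrZ gtr0_norm // mulrC -ler_pdivlMr.
Qed.

Lemma preserves_closure J g : preserves g J -> preserves g (closure J).
Proof.
move=> gJ v /closureP Jv; apply/closureP => e e0.
have D0 : 0 < 1 + d%:R * `|g| by rewrite ltr_pwDl // mulr_ge0.
have [|u Ju vu] := Jv (e / (1 + d%:R * `|g|)); first by rewrite divr_gt0.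
exists (g *m u); first exact: gJ.
rewrite -mulmxBr; apply: le_trans (mulmx_norm_le _ _) _.
apply: (@le_trans _ _ ((1 + d%:R * `|g|) * `|v - u|)).
  by rewrite ler_wpM2r // lerDr.
by rewrite mulrC -ler_pdivlMr.
Qed.

End Cones.

Section ProperCone.
Variables (R : realType) (d : nat).
Local Notation E := 'cV[R]_d.
Variables (O : set E) (f : {scalar E}) (c : R).

(** The bound [poc_f] says that the slice f = 1 of the cone is bounded. *)
Record proper_open_cone : Prop := ProperOpenCone {
  poc_open : open O;
  poc_neq0 : O !=set0;
  pocD : forall u v, O u -> O v -> O (u + v);
  pocZ : forall t v, 0 < t -> O v -> O (t *: v);
  poc_c : 0 < c;
  poc_pos : forall v, O v -> 0 < f v;
  poc_f : forall v, O v -> c * `|v| <= f v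
}.

Hypothesis HO : proper_open_cone.
Local Notation K := (closure O).
Let c0 : 0 < c := poc_c HO.

Lemma poc_nbhs o : O o -> exists2 r : R, 0 < r & forall v, `|v| <= r -> O (o - v).
Proof.
move=> Oo; have /nbhs_closedballP[e eO] : nbhs o O.
  by apply: open_nbhs_nbhs; split=> //; exact: poc_open HO.
exists e%:num => // v ve; apply: eO.
rewrite closed_ballE // /closed_ball_ /=.
by rewrite opprB addrC subrK.
Qed.

Lemma poc_subK : O `<=` K. Proof. exact: subset_closure. Qed.

Lemma pocDK o v : O o -> K v -> O (o + v).
Proof.
move=> Oo /closureP Kv; have [r r0 rO] := poc_nbhs Oo; have [ o' Oo' vo] := Kv _ r0.
rewrite -[v](subrK o') addrA; apply: (pocD HO) => //.
by rewrite -[v - o']opprK opprB; apply: rO; rewrite distrC.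
Qed.

Lemma K_cone : convex_cone K.
Proof. by apply: closure_cone; [exact: poc_neq0 HO|exact: pocD HO|exact: pocZ HO]. Qed.

Definition K0 := cone0 K_cone.
Definition KD := coneD K_cone.
Definition KZ := coneZ K_cone.

Lemma Kf v : K v -> c * `|v| <= f v.
Proof.
move=> /closureP Kv; have [C C0 Cf] := linear_bounded f.
apply/ler_addgt0Pr => z z0.
have e0 : 0 < z / (c + C) by rewrite divr_gt0 // addr_gt0.
have [ o Oo vo] := Kv _ e0; have := poc_f HO Oo.
have : `|v| <= `|o| + z / (c + C).
  by rewrite -lerBlDl (le_trans _ vo) // lerB_dist.
have : f o - f v <= C * (z / (c + C)).
  rewrite -linearB (le_trans (ler_norm _)) // (le_trans (Cf _)) //.
  by rewrite ler_pM2l // distrC.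
set w := z / (c + C) => h1 h2 h3.
have h4 : c * `|v| <= c * (`|o| + w) by rewrite ler_pM2l.
have h5 : (c + C) * w = z by rewrite /w mulrC divfK // gt_eqF // addr_gt0.
rewrite mulrDr in h4; rewrite mulrDl in h5; lra.
Qed.

Lemma Kf_gt0 v : K v -> v != 0 -> 0 < f v.
Proof. by move=> /Kf + v0; apply: lt_le_trans; rewrite mulr_gt0 ?normr_gt0. Qed.

Lemma Kf_ge0 v : K v -> 0 <= f v.
Proof. by move=> /Kf; apply: le_trans; rewrite mulr_ge0 // ltW. Qed.

Lemma K_pointed v : K v -> K (- v) -> v = 0.
Proof.
move=> Kv KNv; apply/eqP/negPn/negP => v0; have := Kf_gt0 Kv v0.
by have := Kf_ge0 KNv; rewrite linearN oppr_ge0 => /le_lt_trans h /h; rewrite ltxx.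
Qed.

(** Order intervals are bounded, because f is increasing for the order and
    controls the norm on K. *)
Lemma K_norm : exists2 C, 0 < C & forall u v, K u -> K (v - u) -> `|u| <= C * `|v|.
Proof.
have [C C0 Cf] := linear_bounded f.
exists (C / c); first by rewrite divr_gt0.
move=> u v Ku Kvu; rewrite mulrAC ler_pdivlMr // mulrC.
apply: le_trans (Kf Ku) _; have := Kf_ge0 Kvu; rewrite linearB subr_ge0.
move=> /le_trans; apply; apply: le_trans (Cf v); exact: ler_norm.
Qed.

Lemma poc_ge o v e : O o -> 0 < e -> K (v - e *: o) -> O v.
Proof.
by move=> Oo e0 Kv; rewrite -[v](subrK (e *: o)) addrC; apply: pocDK => //; exact: pocZ.
Qed.

Lemma poc_dominates o v : O o -> exists2 t : R, 0 < t & O (t *: o - v).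
Proof.
move=> Oo; have [r r0 rO] := poc_nbhs Oo.
pose t := (1 + `|v|) / r.
have v0 : 0 < 1 + `|v| by rewrite ltr_pwDl.
have t0 : 0 < t by rewrite divr_gt0.
exists t => //; have -> : t *: o - v = t *: (o - t^-1 *: v).
  by rewrite scalerBr scalerA mulfV ?scale1r // gt_eqF.
apply: (pocZ HO) => //; apply: rO; rewrite normrZ gtr0_norm ?invr_gt0 // invf_div.
by rewrite mulrAC ler_pdivrMr // ler_pM2l // lerDr.
Qed.

(** A small ball lies in the order interval between - k and k, hence its image
    by g lies between - g k and g k. *)
Lemma preserves_norm k : O k -> exists2 C, 0 < C &
  forall g, preserves g K -> `|g| <= C * `|g *m k|.
Proof.
move=> Ok; have [r r0 rO] := poc_nbhs Ok; have [C C0 CK] := K_norm.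
exists ((C * 2 + 1) / r); first by rewrite divr_gt0 // ltr_wpDl // mulr_ge0 // ltW.
move=> g gK; rewrite mulrAC; set Q := _ * `|_|.
have Q0 : 0 <= Q by rewrite mulr_ge0 // addr_ge0 // mulr_ge0 // ltW.
apply: mx_norm_le => [|i j]; first by rewrite divr_ge0 // ltW.
rewrite ler_pdivlMr //; pose v : E := r *: delta_mx j 0.
have nv : `|v| <= r.
  apply: mx_norm_le => [|a b]; first exact: ltW.
  rewrite !mxE normrM gtr0_norm // ger_pMr // normr_nat.
  by case: (_ && _).
have -> : `|g i j| * r = `|(g *m v) i 0|.
  by rewrite /v -scalemxAr -colE !mxE normrM gtr0_norm // mulrC.
apply: le_trans (mx_entry_norm _ _ _) _.
have K1 : K (k - v) by apply: poc_subK; exact: rO.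
have K2 : K (k + v) by apply: poc_subK; rewrite -[v]opprK; apply: rO; rewrite normrN.
have := CK (g *m (k + v)) (2 *: (g *m k)) (gK _ K2).
rewrite mulmxDr scaler_nat mulr2n opprD addrACA subrr add0r.
rewrite -mulmxBr => /(_ (gK _ K1)); rewrite -mulr2n -scaler_nat normrZ normr_nat => H.
rewrite -[g *m v](addKr (g *m k)) addrC; apply: le_trans (ler_normB _ _) _.
by rewrite /Q mulrDl mul1r lerD2r -mulrA.
Qed.

End ProperCone.

(** * Common eigenvectors of commuting cone maps *)

Section PerronFrobenius.
Variables (R : realType) (d : nat).
Local Notation E := 'cV[R]_d.
Variables (f : {scalar E}) (c : R).
Hypothesis c0 : 0 < c.

Definition f_proper (J : set E) := forall v, J v -> c * `|v| <= f v.

Section OneMap.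
Variables (J : set E) (a : 'M[R]_d).
Hypotheses (Jc : convex_cone J) (Jcl : closed J) (Jf : f_proper J).
Hypothesis aJ : preserves a J.

Let f_gt0 v : J v -> v != 0 -> 0 < f v.
Proof. by move=> /Jf + v0; apply: lt_le_trans; rewrite mulr_gt0 ?normr_gt0. Qed.

Let f_ge0 v : J v -> 0 <= f v.
Proof. by move=> /Jf; apply: le_trans; rewrite mulr_ge0 // ltW. Qed.

Let norm1 v : J v -> f v = 1 -> `|v| <= c^-1.
Proof. by move=> /Jf + f1; rewrite f1 mulrC -ler_pdivlMr // div1r. Qed.

(** The perturbation sends the nonzero vectors of J to order units of J.  Let l
    be the largest number such that b v - l v lies in J for some v of the slice
    f = 1.  If b v - l v were nonzero, applying b to it would give an order
    unit, and b v would allow a number larger than l. *)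
Lemma perturbed_eigenvector (u : E) (e : R) : J u ->
    (forall v, J v -> exists2 t : R, 0 < t & J (u - t *: v)) -> u != 0 -> 0 < e ->
  exists v l, [/\ J v, f v = 1 & a *m v + (e * f v) *: u = l *: v].
Proof.
move=> Ju uJ u0 e0; pose b v := a *m v + (e * f v) *: u.
have bD v w t : b (v - t *: w) = b v - t *: b w.
  have fE : f (v - t *: w) = f v - t * f w by rewrite linearB linearZ.
  rewrite /b mulmxBr -scalemxAr fE.
  by move: (a *m v) (a *m w) => x y; apply/colP => i; rewrite !mxE; ring.
have bJ v : J v -> J (b v).
  by move=> Jv; apply: coneD => //; [exact: aJ|apply: coneZ => //; rewrite mulr_ge0 ?f_ge0 ?ltW].
pose S := [set l | exists v, [/\ J v, f v = 1 & J (b v - l *: v)]].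
have [C C0 fC] := linear_bounded f.
have SC : ubound S (C * (d%:R * `|a| * c^-1) + e * f u).
  move=> l [v [Jv f1 Jl]]; have := f_ge0 Jl.
  rewrite linearB linearZ /= f1 mulr1 subr_ge0 => /le_trans; apply.
  rewrite /b linearD linearZ /= f1 mulr1 lerD2r.
  apply: le_trans (ler_norm _) _; apply: le_trans (fC _) _; rewrite ler_pM2l //.
  apply: le_trans (mulmx_norm_le _ _) _; rewrite ler_wpM2l ?mulr_ge0 //.
  exact: norm1.
have S0 : S !=set0.
  exists 0; exists ((f u)^-1 *: u); have fu := f_gt0 Ju u0.
  have Ju' : J ((f u)^-1 *: u) by apply: coneZ; rewrite // invr_ge0 ltW.
  split=> //; first by rewrite linearZ /= mulVf // gt_eqF.
  by rewrite scale0r subr0; exact: bJ.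
have hS : has_sup S by split=> //; exists (C * (d%:R * `|a| * c^-1) + e * f u).
have [U UU sU] := free_ultrafilter.
have ex n : exists v, [/\ J v, f v = 1 & J (b v - (sup S - n.+1%:R^-1) *: v)].
  have [|l [v [Jv f1 Jl]] sl] := sup_adherent (eps := n.+1%:R^-1) _ hS.
    by rewrite invr_gt0 ltr0n.
  exists v; split=> //; set h := _^-1 in sl *.
  have -> : b v - (sup S - h) *: v = (b v - l *: v) + (l - (sup S - h)) *: v.
    by move: (b v) => x; apply/colP => i; rewrite !mxE; ring.
  by apply: (coneD Jc) => //; apply: coneZ => //; rewrite subr_ge0 ltW.
pose v n := sval (cid (ex n)).
have vP n : [/\ J (v n), f (v n) = 1 & J (b (v n) - (sup S - n.+1%:R^-1) *: v n)].
  by rewrite /v; case: cid.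
have [w vw] : exists w : E, v n @[n --> U] --> w.
  apply: (@ultra_cvg_bounded _ _ _ _ _ _ v c^-1); apply: filterE => n.
  by have [? ? _] := vP n; exact: norm1.
have hn : (n.+1%:R^-1 : R) @[n --> U] --> (0 : R).
  by apply: cvg_trans (@cvg_harmonic R); move=> A; exact: sU.
have Jw : J w.
  by apply: (closed_lim Jcl _ vw); apply: filterE => n; case: (vP n).
have fw : f w = 1.
  by apply: lim_const (linear_cvg f vw) _ => n; case: (vP n).
have bw : J (b w - sup S *: w).
  apply: (@closed_lim _ _ _ _ _ U _ (fun n => b (v n) - (sup S - n.+1%:R^-1) *: v n) _ Jcl).
    by apply: filterE => n; case: (vP n).
  rewrite -[sup S in X in _ --> X]subr0.
  apply: cvgB; first apply: cvgD.
  - by apply: cvg_mulmx => //; exact: cvg_cst.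
  - by apply: cvgZl; apply: cvgMr; exact: linear_cvg.
  - by apply: cvgZ => //; apply: cvgB => //; exact: cvg_cst.
exists w, (sup S); split=> //; apply/eqP; rewrite -subr_eq0; apply/negPn/negP.
rewrite -/(b w) => /(f_gt0 bw) fpos.
have Jbw := bJ _ Jw; have [t t0 Jt] := uJ _ Jbw.
have fbw : 0 < f (b w).
  rewrite /b linearD linearZ /= fw mulr1 ltr_wpDl ?f_ge0 //; first exact: aJ.
  by rewrite mulr_gt0 // f_gt0.
set z := b w - sup S *: w in bw fpos.
have Jz : J (b (b w) - (sup S + e * f z * t) *: b w).
  have bz : b (b w) - sup S *: b w = b z by rewrite -bD.
  rewrite scalerDl opprD addrA bz {1}/b -[(e * f z * t) *: _]scalerA -addrA -scalerBr.
  by apply: (coneD Jc); [exact: aJ|apply: coneZ; rewrite // mulr_ge0 // ltW].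
have : S (sup S + e * f z * t).
  exists ((f (b w))^-1 *: b w); have i0 : 0 <= (f (b w))^-1 by rewrite invr_ge0 ltW.
  split; [exact: coneZ|by rewrite linearZ /= mulVf // gt_eqF|].
  have -> : b ((f (b w))^-1 *: b w) = (f (b w))^-1 *: b (b w).
    have := bD 0 (b w) (- (f (b w))^-1).
    by rewrite !scaleNr !opprK !add0r => ->; rewrite {1}/b mulmx0 linear0 mulr0 scale0r !add0r.
  by rewrite [X in _ - X]scalerA mulrC -scalerA -scalerBr; exact: coneZ.
move=> /(ub_le_sup hS.2); rewrite gerDl leNgt => /negP; apply.
by rewrite !mulr_gt0.
Qed.

(** Perturb the map along an order unit u and let the perturbation tend to 0:
    the eigenvectors accumulate in the compact slice f = 1. *)
Lemma cone_eigenvector : (exists2 v, J v & v != 0) ->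
  exists e, [/\ J e, e != 0 & exists l, a *m e = l *: e].
Proof.
move=> [v Jv v0]; have [s [sJ Js]] := spanning_seq J.
have tJ i : J (tnth (in_tuple s) i) by apply: sJ; exact: mem_tnth.
have [r r0 rJ] := span_order_unit Jc tJ.
set u := \sum_i _ in rJ; have Ju : J u by apply: cone_sum.
have uJ w : J w -> exists2 t : R, 0 < t & J (u - t *: w).
  move=> Jw; have w0 : 0 < 1 + `|w| by rewrite ltr_pwDl.
  exists (r / (1 + `|w|)); first by rewrite divr_gt0.
  apply: rJ; first by rewrite memvZ //; exact: Js.
  rewrite normrZ gtr0_norm ?divr_gt0 // mulrAC ler_pdivrMr // ler_pM2l //.
  by rewrite lerDr.
have u0 : u != 0.
  apply/eqP => u0; have [t t0 Jt] := uJ _ Jv; have := f_ge0 Jt.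
  rewrite u0 sub0r linearN linearZ /= oppr_ge0 leNgt => /negP; apply.
  by rewrite mulr_gt0 // f_gt0.
have ex n := perturbed_eigenvector Ju uJ u0 (ltac:(by rewrite invr_gt0 ltr0n) : 0 < (n.+1%:R^-1 : R)).
pose w n := sval (cid (ex n)).
have wP n : [/\ J (w n), f (w n) = 1 & exists l, a *m w n + (n.+1%:R^-1 * f (w n)) *: u = l *: w n].
  by rewrite /w; case: cid => /= x [l []]; split=> //; exists l.
have [U UU sU] := free_ultrafilter.
have [e we] : exists e : E, w n @[n --> U] --> e.
  apply: (@ultra_cvg_bounded _ _ _ _ _ _ w c^-1); apply: filterE => n.
  by have [? ? _] := wP n; exact: norm1.
have hn : (n.+1%:R^-1 : R) @[n --> U] --> (0 : R).
  by apply: cvg_trans (@cvg_harmonic R); move=> A; exact: sU.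
have Je : J e.
  by apply: (closed_lim Jcl _ we); apply: filterE => n; case: (wP n).
have fe : f e = 1.
  by apply: lim_const (linear_cvg f we) _ => n; case: (wP n).
exists e; split=> //.
  by apply/eqP => e0; move/eqP: fe; rewrite e0 linear0 eq_sym oner_eq0.
exists (f (a *m e)).
pose y n := a *m w n + n.+1%:R^-1 *: u.
have ycv : y n @[n --> U] --> a *m e.
  rewrite -[X in _ --> X]addr0 -(scale0r u); apply: cvgD.
    by apply: cvg_mulmx => //; exact: cvg_cst.
  by apply: cvgZl.
have yE n : y n = f (y n) *: w n.
  have [_ f1 [l]] := wP n; rewrite f1 mulr1 -/(y n) => yl.
  by rewrite {2}yl linearZ /= f1 mulr1.
apply: (mx_lim_unique ycv); under eq_fun do rewrite yE.
by apply: cvgZ => //; exact: linear_cvg.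
Qed.

End OneMap.

(** Among the invariant subspaces that contain a nonzero vector of J, take one
    of least dimension.  A map of the family has in it an eigenvector that lies
    in J; the corresponding eigenspace is again invariant, so it is the whole
    subspace.  Every map of the family is therefore a scalar there. *)
Lemma common_eigenvector (J : set E) (A : set 'M[R]_d) :
    convex_cone J -> closed J -> f_proper J -> (exists2 v, J v & v != 0) ->
    (forall a, A a -> preserves a J) ->
    (forall a b, A a -> A b -> a *m b = b *m a) ->
  exists e, [/\ J e, e != 0 & forall a, A a -> exists l, a *m e = l *: e].
Proof.
move=> Jc Jcl Jf [v0 Jv0 nv0] AJ Acomm.
pose good (W : {vspace E}) := (forall a w, A a -> w \in W -> a *m w \in W) /\
  exists v, [/\ J v, v \in W & v != 0].
pose P n := `[< exists2 W, good W & \dim W = n >].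
have exP : exists n, P n.
  exists (\dim {:E}); apply/asboolP; exists fullv => //.
  by split=> [*|]; [rewrite memvf|exists v0; rewrite memvf].
case: (ex_minnP exP) => n /asboolP[W [WA [v [Jv vW nv]]] Wn] minn.
exists v; split=> // a Aa.
pose JW := J `&` [set w | w \in W].
have [e [[Je /= eW] ne [l ael]]] : exists e, [/\ JW e, e != 0 & exists l, a *m e = l *: e].
  apply: cone_eigenvector.
  - split; first by split; [exact: cone0|exact: mem0v].
    + by move=> x y [Jx xW] [Jy yW]; split; [exact: coneD|exact: rpredD].
    + by move=> t x t0 [Jx xW]; split; [exact: coneZ|exact: rpredZ].
  - apply: closedI => //; exact: subspace_closed.
  - by move=> x [Jx _]; exact: Jf.
  - by move=> x [Jx xW]; split; [exact: AJ|exact: WA].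
  - by exists v.
exists l.
pose gl : 'End(E) := linfun (mulmx (a - l%:M)).
have glE w : gl w = a *m w - l *: w by rewrite lfunE /= mulmxBl mul_scalar_mx.
pose W' := (W :&: lker gl)%VS.
have gW' : good W'.
  split=> [b w Ab|]; last first.
    by exists e; rewrite memv_cap eW memv_ker glE ael subrr eqxx.
  rewrite !memv_cap !memv_ker !glE => /andP[wW /eqP gw].
  rewrite WA //= mulmxA (Acomm _ _ Aa Ab) -mulmxA scalemxAr -mulmxBr gw mulmx0.
  exact: eqxx.
have : v \in W'.
  suff -> : W' = W by [].
  apply/eqP; rewrite -(geq_leqif (dimv_leqif_eq (capvSl _ _))) Wn; apply: minn.
  by apply/asboolP; exists W'.
by rewrite memv_cap memv_ker glE => /andP[_]; rewrite subr_eq0 => /eqP.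
Qed.

End PerronFrobenius.

(** * Groups acting cocompactly on a cone *)

Section CocompactCone.
Variables (R : realType) (d : nat).
Local Notation E := 'cV[R]_d.
Variables (O : set E) (f : {scalar E}) (c : R) (G : set 'M[R]_d) (C : set E).
Local Notation K := (closure O).

(** What remains of a convex cocompact group after choosing lifts.
    [C_cocompact] states cocompactness as the existence of a cluster point
    modulo G, which contains the positive scalars, so that only the directions
    of the vectors matter; [C_limit] says that the boundary points of O that are limits
    of an orbit in O belong to the closure of the core. *)
Record cocompact_cone : Prop := CocompactCone {
  cc_cone : proper_open_cone O f c;
  G_unit : forall g, G g -> g \in unitmx;
  G_mul : forall g h, G g -> G h -> G (g *m h);
  G_inv : forall g, G g -> G (invmx g);
  G_scal : forall t, 0 < t -> G t%:M;
  G_pres : forall g, G g -> preserves g O;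
  G_discrete : exists2 e : R, 0 < e &
    forall g, G g -> `|g - 1%:M| <= e -> exists s, g = s%:M;
  C_sub : C `<=` O;
  C_neq0 : C !=set0;
  C_add : forall u v, C u -> C v -> C (u + v);
  C_scale : forall t v, 0 < t -> C v -> C (t *: v);
  C_pres : forall g, G g -> preserves g C;
  C_cocompact : forall x : nat -> E, (forall n, C (x n)) ->
    exists2 k, C k & forall e, 0 < e -> forall N, exists2 n, (N <= n)%N &
      exists2 g, G g & `|g *m x n - k| <= e;
  C_limit : forall w v, O w -> ~ O v -> v != 0 ->
    (forall e, 0 < e -> exists2 g, G g & `|g *m w - v| <= e) -> closure C v
}.

Hypothesis H : cocompact_cone.
Let HO := cc_cone H.

Lemma G_presK g : G g -> preserves g K.
Proof. by move=> Gg; apply: preserves_closure; exact: G_pres. Qed.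

Lemma harmonic_ultra (U : set_system nat) : \oo `<=` U ->
  (n.+1%:R^-1 : R) @[n --> U] --> (0 : R).
Proof. by move=> sU; apply: cvg_trans (@cvg_harmonic R) => B; exact: sU. Qed.

Lemma cvg_norm_bounded (I : Type) (U : set_system I) {UU : ProperFilter U} m n
    (u : I -> 'M[R]_(m, n)) (l : 'M[R]_(m, n)) :
  u x @[x --> U] --> l -> \forall x \near U, `|u x| <= `|l| + 1.
Proof.
move=> /cvgrPdist_le/(_ 1 ltr01); apply: filterS => x ux.
by rewrite -[u x](subKr l) (le_trans (ler_normB _ _)) // lerD2l.
Qed.

Lemma cvg_half (I : Type) (U : set_system I) {UU : ProperFilter U}
    (u : I -> E) k : O k -> u x @[x --> U] --> k ->
  \forall x \near U, O (u x - 2^-1 *: k).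
Proof.
move=> Ok; have Ok2 : O (2^-1 *: k) by apply: (pocZ HO).
have [r r0 rO] := poc_nbhs HO Ok2.
move=> /cvgrPdist_le/(_ r r0); apply: filterS => x /rO.
rewrite opprB addrCA [X in _ + X](_ : _ = - (2^-1 *: k)) //.
rewrite -{2}[k]scale1r -scalerBl -scaleNr; congr (_ *: _); lra.
Qed.

(** Eventually u x dominates k / 2, so a bound at u x is a bound at k, and
    [preserves_norm] applies. *)
Lemma bounded_at (I : Type) (U : set_system I) {UU : ProperFilter U}
    (u : I -> E) k (g : I -> 'M[R]_d) B : O k -> u x @[x --> U] --> k ->
    (forall x, preserves (g x) K) -> (\forall x \near U, `|g x *m u x| <= B) ->
  exists B', \forall x \near U, `|g x| <= B'.
Proof.
move=> Ok uk gK gB; have [D D0 DP] := preserves_norm HO Ok.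
have [L L0 LP] := K_norm HO.
exists (D * (L * (2 * B))); near=> x.
apply: (le_trans (DP _ (gK x))); rewrite ler_pM2l //.
have Kx : K (2 *: u x - k).
  have -> : 2 *: u x - k = 2 *: (u x - 2^-1 *: k).
    by rewrite scalerBr scalerA mulfV ?scale1r.
  by apply: (KZ HO) => //; apply: poc_subK; near: x; exact: cvg_half.
have := LP (g x *m k) (2 *: (g x *m u x)).
rewrite scalemxAr -mulmxBr => /(_ (gK _ _ (poc_subK Ok)) (gK _ _ Kx)).
move=> /le_trans; apply; rewrite ler_pM2l // -scalemxAr normrZ normr_nat ler_pM2l //.
by near: x.
Unshelve. all: by end_near. Qed.

(** Far enough along U the quotients of two values of g are close to the
    identity, hence scalar. *)
Lemma discrete_ultra (I : Type) (U : set_system I) {UU : UltraFilter U}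
    (g : I -> 'M[R]_d) B :
    (forall x, G (g x)) ->
    (\forall x \near U, `|g x| <= B) -> (\forall x \near U, `|invmx (g x)| <= B) ->
  exists2 S, U S & forall x y, S x -> S y -> exists s, g x = s *: g y.
Proof.
move=> Gg gB gB'.
have [l gl] := ultra_cvg_bounded gB; have [l' gl'] := ultra_cvg_bounded gB'.
have ll' : l' *m l = 1%:M.
  apply: (mx_lim_unique (cvg_mulmx gl' gl)).
  under eq_fun do rewrite mulVmx ?(G_unit H) //.
  exact: cvg_cst.
have [e e0 eP] := G_discrete H.
pose D := d%:R * (`|l'| + 1 + `|l|) + 1.
have D0 : 0 < D by rewrite ltr_wpDl // mulr_ge0 // !addr_ge0.
pose t := Num.min 1 (e / D).
have t0 : 0 < t by rewrite lt_min ltr01 divr_gt0.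
exists [set x | `|l - g x| <= t /\ `|l' - invmx (g x)| <= t].
  apply: filterI.
    exact: ((cvgrPdist_le _ _).1 gl).
  exact: ((cvgrPdist_le _ _).1 gl').
move=> x y [gx _] [_ gy].
have [] := eP (invmx (g y) *m g x); first by apply: (G_mul H); [exact: (G_inv H)|].
  have -> : invmx (g y) *m g x - 1%:M =
      (invmx (g y) - l') *m l - invmx (g y) *m (l - g x).
    by rewrite -ll' mulmxBl mulmxBr opprB [RHS]addrC addrA subrK.
  apply: le_trans (ler_normB _ _) _.
  have ny : `|invmx (g y)| <= `|l'| + 1.
    rewrite -[invmx (g y)](subKr l') (le_trans (ler_normB _ _)) // lerD2l.
    by apply: le_trans gy _; rewrite ge_min lexx.
  rewrite distrC in gy.
  apply: (@le_trans _ _ (D * t)); last first.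
    by rewrite mulrC -ler_pdivlMr // ge_min lexx orbT.
  have := mulmx_norm_le (invmx (g y) - l') l.
  have := mulmx_norm_le (invmx (g y)) (l - g x).
  have : d%:R * `|invmx (g y) - l'| * `|l| <= d%:R * t * `|l|.
    by rewrite ler_wpM2r // ler_wpM2l.
  have : d%:R * `|invmx (g y)| * `|l - g x| <= d%:R * (`|l'| + 1) * t.
    by rewrite ler_pM ?mulr_ge0 // ler_wpM2l.
  rewrite /D; move: `|l'| `|l| (d%:R : R) => p q r; lra.
move=> s gs; exists s.
by rewrite -mul_scalar_mx -scalar_mxC -gs mulKVmx // (G_unit H).
Qed.

Lemma G_1 : G 1%:M. Proof. exact: (G_scal H ltr01). Qed.

Lemma mulmx_neq0 (g : 'M[R]_d) (v : E) : g \in unitmx -> v != 0 -> g *m v != 0.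
Proof. by move=> gu; apply: contra_neq => gv; rewrite -[v](mulKmx gu) gv mulmx0. Qed.

(** Let y n in C tend to x.  Some g n moves y n close to a vector k of C; by
    discreteness the g n are eventually proportional, so that a single one maps
    x to a multiple of k. *)
Lemma C_closed x : closure C x -> O x -> C x.
Proof.
move=> Cx Ox.
have ex n : exists y, C y /\ `|x - y| <= n.+1%:R^-1.
  have n0 : 0 < (n.+1%:R^-1 : R) by rewrite invr_gt0 ltr0n.
  have [y [Cy xy]] := Cx _ (nbhsx_ballx x _ n0).
  by exists y; split=> //; rewrite -ball_normE in xy; exact: ltW.
pose y n := sval (cid (ex n)).
have yC n : C (y n) by rewrite /y; case: cid => ? [].
have yx n : `|x - y n| <= n.+1%:R^-1 by rewrite /y; case: cid => ? [].
have [k Ck kP] := C_cocompact H yC.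
have ex2 j : exists ng : nat * 'M[R]_d,
    [/\ (j <= ng.1)%N, G ng.2 & `|ng.2 *m y ng.1 - k| <= j.+1%:R^-1].
  have [|n jn [g Gg gk]] := kP j.+1%:R^-1 _ j; first by rewrite invr_gt0 ltr0n.
  by exists (n, g).
pose n j := (sval (cid (ex2 j))).1; pose g j := (sval (cid (ex2 j))).2.
have gP j : [/\ (j <= n j)%N, G (g j) & `|g j *m y (n j) - k| <= j.+1%:R^-1].
  by rewrite /n /g; case: cid.
have [U UU sU] := free_ultrafilter.
have cvgn (u : nat -> E) l : (forall j, `|l - u j| <= j.+1%:R^-1) ->
    u j @[j --> U] --> l.
  move=> ul; apply/cvgrPdist_le => /= e e0.
  have /cvgrPdist_le/(_ e e0) := harmonic_ultra sU.
  apply: filterS => j; rewrite sub0r normrN gtr0_norm ?invr_gt0 ?ltr0n //.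
  by apply: le_trans.
have yncv : y (n j) @[j --> U] --> x.
  apply: cvgn => j; apply: le_trans (yx _) _; have [jn _ _] := gP j.
  by rewrite lef_pV2 ?posrE ?ltr0n // ler_nat.
have gcv : g j *m y (n j) @[j --> U] --> k.
  by apply: cvgn => j; rewrite distrC; case: (gP j).
have [B1 gB1] : exists B, \forall j \near U, `|g j| <= B.
  apply: (bounded_at (B := `|k| + 1) Ox yncv) => [j|].
    by apply: G_presK; case: (gP j).
  exact: cvg_norm_bounded.
have [B2 gB2] : exists B, \forall j \near U, `|invmx (g j)| <= B.
  apply: (bounded_at (B := `|x| + 1) (C_sub H Ck) gcv) => [j|].
    by apply: G_presK; apply: (G_inv H); case: (gP j).
  apply: filterS (cvg_norm_bounded yncv) => j; rewrite mulKmx //.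
  by apply: (G_unit H); case: (gP j).
have [S US SP] : exists2 S, U S & forall i j, S i -> S j -> exists s, g i = s *: g j.
  apply: (@discrete_ultra _ U _ g (Num.max B1 B2)).
  - by move=> j; case: (gP j).
  - by apply: filterS gB1 => j; rewrite le_max => ->.
  - by apply: filterS gB2 => j; rewrite le_max => ->; rewrite orbT.
have [j0 Sj0] := filter_ex US.
have [_ Gj0 _] := gP j0; have uj0 := G_unit H Gj0.
pose z := invmx (g j0) *m k.
have Cz : C z by apply: (C_pres H) => //; exact: (G_inv H).
pose u j := invmx (g j0) *m (g j *m y (n j)).
have ucv : u j @[j --> U] --> z by apply: cvg_mulmx => //; exact: cvg_cst.
have e1 : f (u j) *: y (n j) @[j --> U] --> f z *: x.
  exact: cvgZ (linear_cvg f ucv) yncv.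
have e2 : f (u j) *: y (n j) @[j --> U] --> f x *: z.
  have : f (y (n j)) *: u j @[j --> U] --> f x *: z.
    exact: cvgZ (linear_cvg f yncv) ucv.
  apply: cvg_trans; apply: near_eq_cvg; apply: filterS US => j Sj.
  have [s gs] := SP _ _ Sj Sj0.
  have -> : u j = s *: y (n j).
    by rewrite /u gs -scalemxAl -scalemxAr mulKmx.
  have -> : f (s *: y (n j)) = s * f (y (n j)) by rewrite linearZ.
  by rewrite scalerA mulrC.
have e3 := mx_lim_unique e1 e2.
have fz : 0 < f z by apply: (poc_pos HO); exact: (C_sub H).
have fx : 0 < f x by exact: (poc_pos HO).
have -> : x = (f x / f z) *: z.
  by rewrite mulrC -scalerA -e3 scalerA mulVf ?scale1r // gt_eqF.
by apply: (C_scale H) => //; exact: divr_gt0.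
Qed.


(** For o in O these sets are compact, contained in O, and exhaust O as m
    grows. *)
Definition core_window o (m : R) := [set v | K (m *: o - v) /\ K (m *: v - o)].

Lemma cocompact_window o : O o -> exists2 m : R, 0 < m & forall x, C x ->
  exists2 g, G g & core_window o m (g *m x).
Proof.
move=> Oo; apply: contrapT => no.
have ex (n : nat) : exists x, C x /\ forall g, G g -> ~ core_window o n.+1%:R (g *m x).
  apply: contrapT => nx; apply: no; exists n.+1%:R => // x Cx; apply: contrapT => ng.
  by apply: nx; exists x; split=> // g Gg gx; apply: ng; exists g.
pose x n := sval (cid (ex n)).
have [|k Ck kP] := C_cocompact H (x := x).
  by move=> n; rewrite /x; case: cid => ? [].
have Ok := C_sub H Ck.
have [s s0 sP] := poc_dominates HO k Oo.
have [t t0 tP] := poc_dominates HO o Ok.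
have [r r0 rP] := poc_nbhs HO sP.
have [r' r'0 r'P] := poc_nbhs HO tP.
pose e := Num.min r (r' / t).
have e0 : 0 < e by rewrite lt_min r0 divr_gt0.
pose N := Num.bound (Num.max s t).
have [n Nn [g Gg gx]] := kP e e0 N.
have sn : Num.max s t <= n.+1%:R.
  apply: ltW; apply: lt_le_trans (archi_boundP _) _; first by rewrite le_max ltW.
  by rewrite ler_nat -/N (leq_trans Nn).
have := svalP (cid (ex n)); rewrite -/(x n) => -[_ /(_ g Gg)]; apply.
set y := g *m x n in gx *.
have Oy1 : O (s *: o - y).
  have -> : s *: o - y = s *: o - k - (y - k) by rewrite opprB addrA subrK.
  by apply: rP; apply: le_trans gx _; rewrite ge_min lexx.
have Oy2 : O (t *: y - o).
  have -> : t *: y - o = t *: k - o - t *: (k - y).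
    by rewrite scalerBr opprB [RHS]addrC addrA subrK.
  apply: r'P; rewrite normrZ gtr0_norm // distrC mulrC -ler_pdivlMr //.
  by apply: le_trans gx _; rewrite ge_min lexx orbT.
have Oy : O y by apply: (C_sub H); apply: (C_pres H) => //; rewrite /x; case: cid => ? [].
move: sn; rewrite ge_max => /andP[sn tn]; split.
  have -> : n.+1%:R *: o - y = (s *: o - y) + (n.+1%:R - s) *: o.
    by rewrite scalerBl [RHS]addrC addrA subrK.
  apply: (KD HO); first exact: poc_subK.
  by apply: (KZ HO); [rewrite subr_ge0|exact: poc_subK].
have -> : n.+1%:R *: y - o = (t *: y - o) + (n.+1%:R - t) *: y.
  by rewrite scalerBl [RHS]addrC addrA subrK.
apply: (KD HO); first exact: poc_subK.
by apply: (KZ HO); [rewrite subr_ge0|exact: poc_subK].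
Qed.

Lemma cocompact_ultra (I : Type) (U : set_system I) {UU : UltraFilter U}
    (x : I -> E) : (forall i, C (x i)) ->
  exists2 g : I -> 'M[R]_d, (forall i, G (g i)) &
    exists2 k, C k & g i *m x i @[i --> U] --> k.
Proof.
move=> Cx; have [ o Co] := C_neq0 H; have Oo := C_sub H Co.
have [m m0 mP] := cocompact_window Oo.
pose g i := s2val (cid2 (mP _ (Cx i))).
have Gg i : G (g i) by rewrite /g; case: cid2.
have gP i : core_window o m (g i *m x i) by rewrite /g; case: cid2.
exists g => //.
have [L L0 LP] := K_norm HO.
have gC i : C (g i *m x i) by exact: (C_pres H).
have [k gk] : exists k : E, g i *m x i @[i --> U] --> k.
  apply: (@ultra_cvg_bounded _ _ _ _ _ _ (fun i => g i *m x i) (L * `|m *: o|)).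
  apply: filterE => i; have [K1 _] := gP i; apply: LP; last exact: K1.
  by apply: poc_subK; exact: (C_sub H).
exists k => //; apply: C_closed.
  apply: (closed_lim (@closed_closure _ C) _ gk); apply: filterE => i.
  exact: subset_closure.
apply: (poc_ge HO Oo (e := m^-1)); rewrite ?invr_gt0 //.
have -> : k - m^-1 *: o = m^-1 *: (m *: k - o).
  by rewrite scalerBr scalerA mulVf ?scale1r // gt_eqF.
apply: (KZ HO); first by rewrite invr_ge0 ltW.
apply: (@closed_lim _ _ _ _ _ U _ (fun i => m *: (g i *m x i) - o) _ (@closed_closure _ O)).
  by apply: filterE => i; case: (gP i).
by apply: cvgB; [exact: cvgZr|exact: cvg_cst].
Qed.

End CocompactCone.

(** * Cocompactness of centralizers *)

(** The factor is positive because both maps preserve O, and its d-th power is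
    1. *)
Lemma proportional_det (R : realType) (d : nat) (O : set 'cV[R]_d)
    (f : {scalar 'cV[R]_d}) (c : R) (g h : 'M[R]_d) s :
  proper_open_cone O f c -> preserves g O -> preserves h O ->
  h \in unitmx -> g = s *: h -> \det g = \det h -> g = h.
Proof.
move=> HO gO hO hu gs detE.
have [ o Oo] := poc_neq0 HO.
have s0 : 0 < s.
  have := poc_pos HO (gO _ Oo); rewrite gs -scalemxAl linearZ /= pmulr_lgt0 //.
  exact: (poc_pos HO (hO _ Oo)).
case: d O f g h HO gO hO hu gs detE o Oo => [|d] O f g h HO gO hO hu gs detE o Oo.
  by apply/matrixP => -[].
move: detE; rewrite gs detZ => /eqP; rewrite -{2}[\det h]mul1r.
rewrite (inj_eq (mulIf _)) ?pexpr_eq1 // ?ltW // => [/eqP ->|].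
  by rewrite scale1r.
by move: hu; rewrite unitmxE unitfE.
Qed.

Section AbelianCone.
Variables (R : realType) (d : nat).
Local Notation E := 'cV[R]_d.
Variables (O : set E) (f : {scalar E}) (c : R) (G : set 'M[R]_d) (C : set E).
Local Notation K := (closure O).
Hypothesis H : cocompact_cone O f c G C.
Let HO := cc_cone H.
Variable A : set 'M[R]_d.
Hypothesis AG : A `<=` G.

Definition centralizer : set 'M[R]_d :=
  [set z | G z /\ forall a, A a -> z *m a = a *m z].

Lemma centralizer_inv z : centralizer z -> centralizer (invmx z).
Proof.
move=> [Gz zA]; have zu := G_unit H Gz; split=> [|a Aa]; first exact: (G_inv H).
by apply: (canRL (mulmxK zu)); rewrite -mulmxA -zA // mulKmx.
Qed.

Lemma centralizer1 : centralizer 1%:M.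
Proof. by split=> [|a _]; [exact: G_1 H|rewrite mulmx1 mul1mx]. Qed.

(** Bounding the displacement by the order of K, rather than by a distance,
    makes the vectors with given bounds a convex cone. *)
Definition displaced r (a : 'I_r -> 'M[R]_d) (al be : 'I_r -> R) v :=
  forall j, K (a j *m v - al j *: v) /\ K (be j *: v - a j *m v).

(** The conjugates of the a j by the elements g i that bring x i to a compact
    set are bounded together with their inverses.  By discreteness they do not
    depend on i along U, so that quotients of the g i centralize the a j. *)
Lemma centralizer_cocompact r (a : 'I_r -> 'M[R]_d) (al be : 'I_r -> R)
    (I : Type) (U : set_system I) {UU : UltraFilter U} (x : I -> E) :
    (forall j, A (a j)) ->
    (forall z, (forall j, z *m a j = a j *m z) -> forall b, A b -> z *m b = b *m z) ->
    (forall j, 0 < al j) -> (forall i, C (x i)) ->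
    (forall i, displaced a al be (x i)) ->
  exists2 z : I -> 'M[R]_d, (forall i, centralizer (z i)) &
    exists2 k, C k & z i *m x i @[i --> U] --> k.
Proof.
move=> Aa aA al0 Cx xD.
have [g Gg [k Ck gk]] := cocompact_ultra H (U := U) Cx.
have Ok := C_sub H Ck.
have [L L0 LP] := K_norm HO.
pose b j i := g i *m a j *m invmx (g i).
have gu i := G_unit H (Gg i).
have au j := G_unit H (AG (Aa j)).
have Gb j i : G (b j i).
  by apply: (G_mul H); [apply: (G_mul H) => //; exact: AG|exact: (G_inv H)].
have KCg i : K (g i *m x i) by apply: poc_subK; apply: (C_sub H); exact: (C_pres H).
have nbd j : exists B, \forall i \near U, `|b j i| <= B.
  apply: (bounded_at H (B := L * (`|be j| * (`|k| + 1))) Ok gk) => [i|].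
    exact: (G_presK H).
  apply: filterS (cvg_norm_bounded gk) => i gi.
  have -> : b j i *m (g i *m x i) = g i *m (a j *m x i).
    by rewrite /b -!mulmxA mulKmx.
  have [_ Kb] := xD i j.
  apply: (@le_trans _ _ (L * `|be j *: (g i *m x i)|)).
    apply: LP.
      apply: (G_presK H (Gg i)); apply: (G_presK H (AG (Aa j))).
      by apply: poc_subK; exact: (C_sub H (Cx i)).
    by rewrite scalemxAr -mulmxBr; exact: (G_presK H (Gg i) Kb).
  by rewrite ler_pM2l // normrZ ler_wpM2l.
have nbd' j : exists B, \forall i \near U, `|invmx (b j i)| <= B.
  apply: (bounded_at H (B := L * ((al j)^-1 * (`|k| + 1))) Ok gk) => [i|].
    by apply: (G_presK H); exact: (G_inv H).
  apply: filterS (cvg_norm_bounded gk) => i gi.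
  have -> : invmx (b j i) *m (g i *m x i) = g i *m (invmx (a j) *m x i).
    apply: (canLR (mulKmx (G_unit H (Gb j i)))).
    by rewrite /b -!mulmxA (mulKmx (gu i)) mulKVmx.
  have [Kb _] := xD i j.
  apply: (@le_trans _ _ (L * `|(al j)^-1 *: (g i *m x i)|)).
    apply: LP.
      apply: (G_presK H (Gg i)); apply: (G_presK H (G_inv H (AG (Aa j)))).
      by apply: poc_subK; exact: (C_sub H (Cx i)).
    have -> : (al j)^-1 *: (g i *m x i) - g i *m (invmx (a j) *m x i) =
        g i *m (invmx (a j) *m ((al j)^-1 *: (a j *m x i - al j *: x i))).
      rewrite scalerBr scalerA mulVf ?gt_eqF // scale1r mulmxBr -scalemxAr mulKmx //.
      by rewrite mulmxBr -scalemxAr.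
    apply: (G_presK H (Gg i)); apply: (G_presK H (G_inv H (AG (Aa j)))).
    by apply: (KZ HO _ Kb); rewrite invr_ge0 ltW.
  by rewrite ler_pM2l // normrZ gtr0_norm ?invr_gt0 // ler_wpM2l // invr_ge0 ltW.
have disc j : exists2 S, U S & forall i i', S i -> S i' -> b j i = b j i'.
  have [B bB] := nbd j; have [B' bB'] := nbd' j.
  have [S US SP] : exists2 S, U S &
      forall i i', S i -> S i' -> exists s, b j i = s *: b j i'.
    apply: (@discrete_ultra _ _ _ _ _ _ _ H _ U _ (b j) (Num.max B B') (Gb j)).
      by apply: filterS bB => i; rewrite le_max => ->.
    by apply: filterS bB' => i; rewrite le_max => ->; rewrite orbT.
  exists S => // i i' Si Si'; have [s bs] := SP _ _ Si Si'.
  apply: (proportional_det HO _ _ _ bs); try exact: (G_pres H).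
    exact: (G_unit H).
  rewrite /b !det_mulmx !det_inv mulrAC mulfV ?mul1r; last by rewrite -unitfE -unitmxE.
  by rewrite mulrAC mulfV ?mul1r // -unitfE -unitmxE.
pose S j := s2val (cid2 (disc j)).
have US : \forall i \near U, forall j, S j i.
  by apply: filter_forall => j; rewrite /S; case: cid2.
have SP j i i' : S j i -> S j i' -> b j i = b j i'.
  by rewrite /S; case: cid2 => /= T _; apply.
have [i0 Si0] := filter_ex US.
pose z i := if `[< forall j, S j i >] then invmx (g i0) *m g i else 1%:M.
exists z => [i|].
  rewrite /z; case: asboolP => [Si|_]; last exact: centralizer1.
  split; first by apply: (G_mul H) => //; exact: (G_inv H).
  apply: aA => j; have := SP j _ _ (Si j) (Si0 j).
  rewrite /b => /(canRL (mulmxKV (gu i))) e.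
  by rewrite -mulmxA e !mulmxA mulVmx // mul1mx.
exists (invmx (g i0) *m k).
  by apply: (C_pres H) => //; exact: (G_inv H).
have : invmx (g i0) *m (g i *m x i) @[i --> U] --> invmx (g i0) *m k.
  by apply: cvg_mulmx => //; exact: cvg_cst.
apply: cvg_trans; apply: near_eq_cvg; apply: filterS US => i Si.
by rewrite /z; case: asboolP => [_|//]; rewrite mulmxA.
Qed.

End AbelianCone.

(** * Degenerations along the centralizer *)

Section Degeneration.
Variables (R : realType) (d : nat).
Local Notation E := 'cV[R]_d.
Variables (O : set E) (f : {scalar E}) (c : R) (G : set 'M[R]_d) (C : set E).
Local Notation K := (closure O).
Hypothesis H : cocompact_cone O f c G C.
Let HO := cc_cone H.
Variable A : set 'M[R]_d.
Hypothesis AG : A `<=` G.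
Local Notation Z := (centralizer G A).

Lemma C_cone : convex_cone (closure C).
Proof. by apply: closure_cone; [exact: C_neq0 H|exact: C_add H|exact: C_scale H]. Qed.

Lemma C_subK : closure C `<=` K.
Proof. by move=> v Cv; apply: closure_subset Cv; exact: C_sub H. Qed.

Lemma C_ray h p t : closure C h -> C p -> 0 < t -> C (h + t *: p).
Proof.
move=> Ch Cp t0; apply: (C_closed H).
  apply: (coneD C_cone) => //; apply: (coneZ C_cone); first exact: ltW.
  exact: subset_closure.
rewrite addrC; apply: (pocDK HO); last exact: C_subK.
by apply: (pocZ HO) => //; exact: (C_sub H).
Qed.

Lemma lim_preserves (I : Type) (U : set_system I) {UU : ProperFilter U}
    (z : I -> 'M[R]_d) (T : 'M[R]_d) (J : set E) : closed J -> (forall n, preserves (z n) J) ->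
  z n @[n --> U] --> T -> preserves T J.
Proof.
move=> Jcl zJ zT v Jv; apply: (@closed_lim _ _ _ _ _ U _ (fun n => z n *m v) _ Jcl).
  by apply: filterE => n; exact: zJ.
by apply: cvg_mulmx => //; exact: cvg_cst.
Qed.

Lemma lim_commute (I : Type) (U : set_system I) {UU : ProperFilter U}
    (z : I -> 'M[R]_d) (T : 'M[R]_d) a : (forall n, z n *m a = a *m z n) ->
  z n @[n --> U] --> T -> T *m a = a *m T.
Proof.
move=> za zT; apply: (mx_lim_unique (u := fun n => z n *m a) (F := U)).
  by apply: cvg_mulmx => //; exact: cvg_cst.
under eq_fun do rewrite za.
by apply: cvg_mulmx => //; exact: cvg_cst.
Qed.

Section FiniteFamily.
Variables (r : nat) (a : 'I_r -> 'M[R]_d).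
Hypothesis Aa : forall j, A (a j).
Hypothesis aA : forall z, (forall j, z *m a j = a j *m z) ->
  forall b, A b -> z *m b = b *m z.

Definition bounded_displacement v :=
  exists al be, (forall j, 0 < al j) /\ displaced O a al be v.

Lemma displaced_weaken al be al' be' v : K v -> (forall j, al' j <= al j) ->
  (forall j, be j <= be' j) -> displaced O a al be v -> displaced O a al' be' v.
Proof.
move=> Kv la lb D j; have [D1 D2] := D j; split.
  have -> : a j *m v - al' j *: v = (a j *m v - al j *: v) + (al j - al' j) *: v.
    by rewrite scalerBl addrA subrK.
  by apply: (KD HO D1); apply: (KZ HO _ Kv); rewrite subr_ge0.
have -> : be' j *: v - a j *m v = (be j *: v - a j *m v) + (be' j - be j) *: v.
  by rewrite scalerBl [RHS]addrC addrA subrK.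
by apply: (KD HO D2); apply: (KZ HO _ Kv); rewrite subr_ge0.
Qed.

Lemma displacedD al be u v :
  displaced O a al be u -> displaced O a al be v -> displaced O a al be (u + v).
Proof.
move=> Du Dv j; have [u1 u2] := Du j; have [v1 v2] := Dv j; split.
  by rewrite mulmxDr scalerDr opprD addrACA; exact: (KD HO u1 v1).
by rewrite mulmxDr scalerDr opprD addrACA; exact: (KD HO u2 v2).
Qed.

Lemma displacedZ al be t v : 0 <= t ->
  displaced O a al be v -> displaced O a al be (t *: v).
Proof.
move=> t0 D j; have [D1 D2] := D j.
rewrite -scalemxAr !scalerA ![_ * t]mulrC -!scalerA -!scalerBr.
by split; [exact: (KZ HO t0 D1)|exact: (KZ HO t0 D2)].
Qed.

Lemma displaced0 al be : displaced O a al be 0.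
Proof. by move=> j; rewrite mulmx0 !scaler0 subrr; split; exact: (K0 HO). Qed.

Lemma bounded_displacementD u v : K u -> K v ->
  bounded_displacement u -> bounded_displacement v -> bounded_displacement (u + v).
Proof.
move=> Ku Kv [al [be [al0 Du]]] [al' [be' [al'0 Dv]]].
exists (fun j => Num.min (al j) (al' j)), (fun j => Num.max (be j) (be' j)).
split=> [j|]; first by rewrite lt_min al0 al'0.
by apply: displacedD; [apply: displaced_weaken Du|apply: displaced_weaken Dv] => // j;
  rewrite ?ge_min ?le_max lexx ?orbT.
Qed.

Lemma bounded_displacementO p : O p -> bounded_displacement p.
Proof.
move=> Op; have aG j := AG (Aa j).
have ex1 j := poc_dominates HO p (G_pres H (aG j) Op).
have ex2 j := poc_dominates HO (a j *m p) Op.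
pose al j := s2val (cid2 (ex1 j)); pose be j := s2val (cid2 (ex2 j)).
have al0 j : 0 < al j by rewrite /al; case: cid2.
exists (fun j => (al j)^-1), be; split=> [j|j]; first by rewrite invr_gt0.
split; last by rewrite /be; case: cid2 => /= t _ ?; exact: poc_subK.
have -> : a j *m p - (al j)^-1 *: p = (al j)^-1 *: (al j *: (a j *m p) - p).
  by rewrite scalerBr scalerA mulVf ?scale1r // gt_eqF.
apply: (KZ HO); first by rewrite invr_ge0 ltW.
by apply: poc_subK; rewrite /al; case: cid2.
Qed.

Lemma eigen_gt0 e b l : G b -> K e -> e != 0 -> b *m e = l *: e -> 0 < l.
Proof.
move=> Gb Ke e0 be.
have : 0 < f (b *m e).
  by apply: (Kf_gt0 HO); [exact: (G_presK H)|apply: mulmx_neq0; rewrite ?(G_unit H)].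
by rewrite be linearZ /= pmulr_lgt0 // (Kf_gt0 HO).
Qed.

Lemma bounded_displacement_eigen e : K e -> e != 0 ->
  (forall j, exists l, a j *m e = l *: e) -> bounded_displacement e.
Proof.
move=> Ke e0 ae; pose l j := sval (cid (ae j)).
have lP j : a j *m e = l j *: e by rewrite /l; case: cid.
exists l, l; split=> [j|j].
  by apply: eigen_gt0 (lP j) => //; apply: AG.
by rewrite lP subrr; split; exact: (K0 HO).
Qed.

(** The vectors h + p / n have uniformly bounded displacement, so elements of
    the centralizer bring them back near some k of C.  The parts of k coming
    from h and from p / n are y and x, and T is the limit of the inverse
    motion. *)
Lemma degeneration h p : closure C h -> bounded_displacement h -> C p ->
  exists U : set_system nat, UltraFilter U /\
  exists (z : nat -> 'M[R]_d) (T : 'M[R]_d) (y x : E), [/\ forall n, Z (z n), z n @[n --> U] --> T,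
    closure C y /\ invmx (z n) *m h @[n --> U] --> y, C (y + x) & closure C x] /\
    T *m y = h /\ T *m x = 0.
Proof.
move=> Ch Bh Cp; have Op := C_sub H Cp.
have [U UU sU] := free_ultrafilter.
exists U; split=> //.
have [al [be [al0 Dh]]] := Bh; have [al' [be' [al'0 Dp]]] := bounded_displacementO Op.
pose t n : R := n.+1%:R^-1; have t0 n : 0 < t n by rewrite invr_gt0 ltr0n.
pose q n := h + t n *: p.
have Cq n : C (q n) by exact: C_ray.
have Dq n : displaced O a (fun j => Num.min (al j) (al' j))
   (fun j => Num.max (be j) (be' j)) (q n).
  apply: displacedD.
    apply: displaced_weaken Dh => [|j|j]; first exact: C_subK.
      by rewrite ge_min lexx.
    by rewrite le_max lexx.
  apply: displacedZ; first exact: ltW.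
  apply: displaced_weaken Dp => [|j|j]; first exact: poc_subK.
    by rewrite ge_min lexx orbT.
  by rewrite le_max lexx orbT.
have [j|w wZ [k Ck wk]] := centralizer_cocompact H AG (U := U) Aa aA _ Cq Dq.
  by rewrite lt_min al0 al'0.
have wG n : G (w n) by have [] := wZ n.
have wu n := G_unit H (wG n).
pose z n := invmx (w n).
have zZ n : Z (z n) by exact: (centralizer_inv H).
have zG n : G (z n) by have [] := zZ n.
have tcv : t n *: p @[n --> U] --> (0 : E).
  by rewrite -(scale0r p); apply: cvgZl; exact: harmonic_ultra.
have qcv : q n @[n --> U] --> h.
  by rewrite -[X in _ --> X]addr0; apply: cvgD => //; exact: cvg_cst.
have [B zB] : exists B, \forall n \near U, `|z n| <= B.
  apply: (bounded_at H (B := `|h| + 1) (C_sub H Ck) wk) => [n|]; first exact: (G_presK H).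
  by apply: filterS (cvg_norm_bounded qcv) => n; rewrite mulKmx.
have [T zT] := ultra_cvg_bounded zB.
have [L L0 LP] := K_norm HO.
have Cwh n : closure C (w n *m h).
  by apply: preserves_closure Ch; exact: (C_pres H).
have [y wy] : exists y : E, w n *m h @[n --> U] --> y.
  apply: (@ultra_cvg_bounded _ _ _ _ _ _ (fun n => w n *m h) (L * (`|k| + 1))).
  apply: filterS (cvg_norm_bounded wk) => n wn.
  apply: (@le_trans _ _ (L * `|w n *m q n|)); last by rewrite ler_pM2l.
  apply: LP; first exact: C_subK.
  rewrite -mulmxBr /q addrC addKr; apply: (G_presK H (wG n)).
  by apply: poc_subK; exact: (pocZ HO).
have wx : w n *m (t n *: p) @[n --> U] --> k - y.
  have -> : (fun n => w n *m (t n *: p)) = (fun n => w n *m q n - w n *m h).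
    by apply/funext => n; rewrite -mulmxBr /q addrC addKr.
  exact: cvgB.
exists z, T, y, (k - y); split; last split.
- split; [exact: zZ|exact: zT| |by rewrite addrC subrK|].
    split; last by under eq_fun do rewrite /z invmxK.
    by apply: (closed_lim (@closed_closure _ C) _ wy); exact: filterE.
  apply: (closed_lim (@closed_closure _ C) _ wx); apply: filterE => n.
  by apply: subset_closure; apply: (C_pres H) => //; exact: (C_scale H).
- apply: (mx_lim_unique (cvg_mulmx zT wy)).
  under eq_fun do rewrite mulKmx //.
  exact: cvg_cst.
- apply: (mx_lim_unique (cvg_mulmx zT wx)).
  under eq_fun do rewrite mulKmx //.
  exact: tcv.
Qed.

End FiniteFamily.

(** As j dominates a multiple of y, its image T j dominates a multiple of
    T y = j.  The same holds for z n j when n is large, and this bounds the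
    inverses of the z n on W.  Then v is the limit of the inverse images of
    T v, which lie in J. *)
Lemma degeneration_injective (U : set_system nat) {UU : ProperFilter U}
    (z : nat -> 'M[R]_d) (T : 'M[R]_d) (W : {vspace E}) (J : set E) (j y : E) (r : R) :
    (forall n, z n \in unitmx) -> z n @[n --> U] --> T ->
    convex_cone J -> closed J -> J `<=` K -> (forall v, J v -> v \in W) ->
    (forall n, preserves (z n) J) -> (forall n, preserves (invmx (z n)) J) ->
    0 < r -> (forall v, v \in W -> `|v| <= r -> J (j - v)) ->
    J y -> T *m y = j ->
  forall v, v \in W -> J (T *m v) -> J v.
Proof.
move=> zu zT Jc Jcl JK JW zJ zJ' r0 rJ Jy Ty.
have TJ : preserves T J by exact: lim_preserves zT.
have Jj : J j by rewrite -Ty; exact: TJ.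
have jW := JW _ Jj.
have spanned v : v \in W -> exists2 s : R, 0 < s & J (s *: j - v).
  move=> vW; pose s := (1 + `|v|) / r.
  have s0 : 0 < s by rewrite divr_gt0 // ltr_pwDl.
  exists s => //; have -> : s *: j - v = s *: (j - s^-1 *: v).
    by rewrite scalerBr scalerA mulfV ?scale1r // gt_eqF.
  apply: (coneZ Jc); first exact: ltW.
  apply: rJ; first by rewrite memvZ.
  rewrite normrZ gtr0_norm ?invr_gt0 // invf_div mulrAC ler_pdivrMr ?ltr_pwDl //.
  by rewrite ler_pM2l // lerDr.
have zW n v : v \in W -> z n *m v \in W.
  move=> vW; have [s s0 Js] := spanned _ vW.
  have -> : v = s *: j - (s *: j - v) by rewrite subKr.
  rewrite mulmxBr rpredB //; apply: JW; apply: zJ => //.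
  by apply: (coneZ Jc) => //; exact: ltW.
have [s s0 Js] := spanned _ (JW _ Jy).
have JTj : J (s *: (T *m j) - j) by have := TJ _ Js; rewrite mulmxBr Ty -scalemxAr.
(* One half of j / s is kept, the other absorbs the error T j - z n j. *)
have [e e0 se] : exists2 e : R, 0 < e & s^-1 = e + e.
  by exists (s^-1 / 2); [rewrite divr_gt0 // invr_gt0|exact: splitr].
have zj : \forall n \near U, J (z n *m j - e *: j).
  have zTj : z n *m j @[n --> U] --> T *m j by apply: cvg_mulmx => //; exact: cvg_cst.
  have /cvgrPdist_le/(_ (e * r)) := zTj; rewrite mulr_gt0 // => /(_ isT).
  apply: filterS => n zn.
  have -> : z n *m j - e *: j =
     s^-1 *: (s *: (T *m j) - j) + e *: (j - e^-1 *: (T *m j - z n *m j)).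
    rewrite !scalerBr !scalerA mulVf ?mulfV ?gt_eqF // !scale1r.
    rewrite se; move: (T *m j) (z n *m j) => p q; apply/colP => i; rewrite !mxE; ring.
  apply: (coneD Jc); apply: (coneZ Jc) => //; [by rewrite invr_ge0 ltW|exact: ltW|].
  apply: rJ; first by rewrite memvZ // rpredB ?zW //; apply: JW; exact: TJ.
  by rewrite normrZ gtr0_norm ?invr_gt0 // ler_pdivrMl.
have [L L0 LP] := K_norm HO.
pose M := (L * `|(2 / e) *: j| + `|e^-1 *: j|) / r.
have zM : \forall n \near U, forall v, v \in W -> `|invmx (z n) *m v| <= M * `|v|.
  apply: filterS zj => n zn v vW.
  have [->|v0] := eqVneq v 0; first by rewrite mulmx0 !normr0 mulr0.
  have nv : 0 < `|v| by rewrite normr_gt0.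
  pose t := r / `|v|; have t0 : 0 < t by rewrite divr_gt0.
  pose u := invmx (z n) *m (t *: v).
  have half u' : `|u'| <= r -> u' \in W -> J (e^-1 *: j - invmx (z n) *m u').
    move=> nu uW.
    have -> : e^-1 *: j - invmx (z n) *m u' =
        e^-1 *: (invmx (z n) *m (z n *m j - e *: j)) + invmx (z n) *m (j - u').
      rewrite !mulmxBr mulKmx // -scalemxAr scalerBr scalerA mulVf ?gt_eqF // scale1r.
      by rewrite addrA subrK.
    apply: (coneD Jc); last by apply: zJ'; exact: rJ.
    by apply: (coneZ Jc); [rewrite invr_ge0 ltW|exact: zJ'].
  have nt : `|t *: v| <= r by rewrite normrZ gtr0_norm // divfK // gt_eqF.
  have J1 := half (t *: v) nt (memvZ _ vW).
  have J2 : J (e^-1 *: j + u).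
    by rewrite -[u]opprK -mulmxN; apply: half; rewrite ?normrN // memvN memvZ.
  have nu : `|e^-1 *: j + u| <= L * `|(2 / e) *: j|.
    apply: LP; first exact: JK.
    have -> : (2 / e) *: j - (e^-1 *: j + u) = e^-1 *: j - u.
      by rewrite mulrDl mul1r scalerDl opprD addrACA subrr add0r.
    exact: JK.
  have : t * `|invmx (z n) *m v| <= M * r.
    rewrite -{1}(gtr0_norm t0) -normrZ scalemxAr -/u /M divfK ?gt_eqF //.
    rewrite -[u](addKr (e^-1 *: j)) addrC (le_trans (ler_normB _ _)) //.
    by rewrite lerD2r.
  by rewrite /t mulrAC ler_pdivrMr // -mulrA [r * _]mulrC mulrA mulrAC ler_pM2r.
have M0 : 0 <= M by rewrite divr_ge0 ?addr_ge0 ?mulr_ge0 // ltW.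
move=> v vW JTv.
apply: (@closed_lim _ _ _ _ _ U _ (fun n => invmx (z n) *m (T *m v)) _ Jcl).
  by apply: filterE => n; exact: zJ'.
apply/cvgrPdist_le => /= q q0.
have zTv : z n *m v @[n --> U] --> T *m v by apply: cvg_mulmx => //; exact: cvg_cst.
have /cvgrPdist_le/(_ (q / (M + 1))) := zTv.
rewrite divr_gt0 ?ltr_wpDl // => /(_ isT) zTv'.
near=> n.
rewrite -{1}[v](mulKmx (zu n)) -mulmxBr.
have nM : forall v, v \in W -> `|invmx (z n) *m v| <= M * `|v| by near: n.
apply: le_trans (nM _ _) _; first by rewrite rpredB ?zW //; apply: JW.
rewrite distrC; apply: (@le_trans _ _ ((M + 1) * `|T *m v - z n *m v|)).
  by rewrite ler_wpM2r // lerDl.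
rewrite mulrC -ler_pdivlMr ?ltr_wpDl //; near: n; exact: zTv'.
Unshelve. all: by end_near. Qed.

End Degeneration.

(** * The span of the fixed directions *)

Section FixedCone.
Variables (R : realType) (d : nat).
Local Notation E := 'cV[R]_d.
Variables (O : set E) (f : {scalar E}) (c : R) (G : set 'M[R]_d) (C : set E).
Local Notation K := (closure O).
Hypothesis H : cocompact_cone O f c G C.
Let HO := cc_cone H.
Variable A : set 'M[R]_d.
Hypothesis AG : A `<=` G.
Hypothesis Acomm : forall a b, A a -> A b -> a *m b = b *m a.
Hypothesis Ainf : exists a : nat -> 'M[R]_d, (forall n, A (a n)) /\
  forall n m s, a n = s *: a m -> n = m.
Local Notation Z := (centralizer G A).

Definition fixed_vector : set E := [set e | [/\ closure C e, e != 0 &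
  forall a, A a -> exists l, a *m e = l *: e]].

Lemma centralizer_fixed z e : Z z -> fixed_vector e -> fixed_vector (z *m e).
Proof.
move=> [Gz zA] [Ce e0 ae]; split=> [||a Aa].
- by apply: preserves_closure Ce; exact: (C_pres H).
- by apply: mulmx_neq0; rewrite ?(G_unit H).
by have [l al] := ae _ Aa; exists l; rewrite mulmxA -zA // -mulmxA al scalemxAr.
Qed.

(** Rescaled so as to fix an interior vector, the infinitely many elements of A
    would form a bounded subset of the discrete group G. *)
Lemma fixed_vector_boundary e : fixed_vector e -> ~ O e.
Proof.
move=> [_ e0 ae] Oe; have [a [Aa a_inj]] := Ainf.
pose l n := sval (cid (ae _ (Aa n))).
have lP n : a n *m e = l n *: e by rewrite /l; case: cid.
have aG n := AG (Aa n).
have l0 n : 0 < l n by exact: (eigen_gt0 H (aG n) (poc_subK Oe) e0 (lP n)).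
pose g n := (l n)^-1 *: a n.
have gG n : G (g n).
  by rewrite /g -mul_scalar_mx; apply: (G_mul H) => //; apply: (G_scal H); rewrite invr_gt0.
have ge n : g n *m e = e by rewrite -scalemxAl lP scalerA mulVf ?scale1r // gt_eqF.
have ge' n : invmx (g n) *m e = e.
  by apply: (canLR (mulKmx (G_unit H (gG n)))); rewrite ge.
have [D D0 DP] := preserves_norm HO Oe.
have [U UU sU] := free_ultrafilter.
have [S US SP] : exists2 S, U S & forall x y, S x -> S y -> exists s, g x = s *: g y.
  apply: (@discrete_ultra _ _ _ _ _ _ _ H _ U _ g (D * `|e|) gG); apply: filterE => n.
    by have := DP _ (G_presK H (gG n)); rewrite ge.
  by have := DP _ (G_presK H (G_inv H (gG n))); rewrite ge'.
have [n Sn] := filter_ex US.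
have [m [Sm nm]] : exists m, S m /\ (n < m)%N.
  have : U (S `&` [set m | (n < m)%N]).
    by apply: filterI => //; apply: sU; exists n.+1.
  by move=> /filter_ex[m [Sm nm]]; exists m.
have [s gs] := SP _ _ Sn Sm.
have : a n = (l n * s * (l m)^-1) *: a m.
  have -> : a n = l n *: g n by rewrite scalerA mulfV ?scale1r // gt_eqF.
  by rewrite gs /g !scalerA ?mulrA.
by move=> /a_inj nmE; move: nm; rewrite nmE ltnn.
Qed.

(** Applying the n-th power of b to v <= s u gives v <= s (l / m)^n u. *)
Lemma eigen_dominated_lt b u v l m s : G b -> K u -> K v ->
    b *m u = l *: u -> b *m v = m *: v -> 0 < l -> l < m -> 0 < s ->
    K (s *: u - v) -> v = 0.
Proof.
move=> Gb Ku Kv bu bv l0 lm s0 Ksv; have m0 := lt_trans l0 lm.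
have Kn n : K ((s * (l / m) ^+ n) *: u - v).
  elim: n => [|n IH]; first by rewrite expr0 mulr1.
  set w := (X in K X).
  have -> : w = m^-1 *: (b *m ((s * (l / m) ^+ n) *: u - v)).
    rewrite mulmxBr -scalemxAr bu bv scalerBr !scalerA mulVf ?scale1r; last by rewrite gt_eqF.
    by rewrite /w; congr (_ *: _ - _); rewrite exprSr mulrA [m^-1 * _]mulrC -!mulrA; do 2 congr (_ * _); rewrite mulrC.
  by apply: (KZ HO); [rewrite invr_ge0 ltW|exact: (G_presK H)].
apply: (K_pointed HO Kv); rewrite -[- v]add0r -(scale0r u).
have q : `|l / m| < 1 by rewrite gtr0_norm ?divr_gt0 // ltr_pdivrMr // mul1r.
apply: (@closed_lim _ _ _ _ _ \oo _ (fun n => (s * (l / m) ^+ n) *: u - v) _ (@closed_closure _ O)).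
  exact: filterE.
apply: cvgB; last exact: cvg_cst.
by apply: cvgZl; rewrite -(mulr0 s); apply: cvgMr; exact: cvg_expr.
Qed.

Lemma eigen_dominated b u v l m s : G b -> K u -> K v -> u != 0 ->
    b *m u = l *: u -> b *m v = m *: v -> l != m -> 0 < s ->
    K (s *: u - v) -> v = 0.
Proof.
move=> Gb Ku Kv u0 bu bv lm s0 Ksv.
apply/eqP/negPn/negP => v0.
have l0 := eigen_gt0 H Gb Ku u0 bu; have m0 := eigen_gt0 H Gb Kv v0 bv.
have inv w q : 0 < q -> b *m w = q *: w -> invmx b *m w = q^-1 *: w.
  move=> q0 bw; apply: (canLR (mulKmx (G_unit H Gb))).
  by rewrite -scalemxAr bw scalerA mulVf ?scale1r // gt_eqF.
move/eqP: v0; apply; move: lm; rewrite neq_lt => /orP[lm|ml].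
  exact: (@eigen_dominated_lt b u v l m s).
apply: (@eigen_dominated_lt (invmx b) u v l^-1 m^-1 s) => //.
- exact: (G_inv H).
- exact: inv.
- exact: inv.
- by rewrite invr_gt0.
- by rewrite ltf_pV2.
Qed.

(** If the closure of C contains a boundary vector e of K, then it contains the
    closed face of K around e.  Elements of G bring the ray e + p / n back near some k of C; as v
    is dominated by e, its images stay bounded and converge to some w.  The
    inverse motion sends k + t w, which lies in O, to e + t v, so that e + t v
    is a limit of an orbit, and v is the limit of e / t + v. *)
Lemma face_in_core e v s : closure C e -> ~ O e -> K v -> 0 < s ->
  K (s *: e - v) -> closure C v.
Proof.
move=> Ce nOe Kv s0 Ksv; have Ke := C_subK H Ce.
have [p Cp] := C_neq0 H; have Op := C_sub H Cp.
have [->|v0] := eqVneq v 0; first exact: (cone0 (C_cone H)).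
have e0 : e != 0.
  apply/eqP => e0; move/eqP: v0; apply; apply: (K_pointed HO Kv).
  by rewrite e0 scaler0 sub0r in Ksv.
have far t : 0 < t -> closure C (e + t *: v).
  move=> t0.
  have nO : ~ O (e + t *: v).
    move=> Oev; apply: nOe.
    apply: (poc_ge HO Oev (e := (1 + t * s)^-1)).
      by rewrite invr_gt0 addr_gt0 // mulr_gt0.
    have u0 : 1 + t * s != 0 by rewrite gt_eqF // addr_gt0 // mulr_gt0.
    have -> : e - (1 + t * s)^-1 *: (e + t *: v) = (t / (1 + t * s)) *: (s *: e - v).
      apply/colP => i; rewrite !mxE; field.
      by move: u0; rewrite mulrC.
    by apply: (KZ HO) => //; rewrite divr_ge0 ?ltW // addr_gt0 // mulr_gt0.
  have Kev : K (e + t *: v) by exact: (KD HO Ke (KZ HO (ltW t0) Kv)).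
  have [U UU sU] := free_ultrafilter.
  pose h n : R := n.+1%:R^-1; have h0 n : 0 < h n by rewrite invr_gt0 ltr0n.
  pose q n := e + h n *: p.
  have Cq n : C (q n) by exact: (C_ray H).
  have [g gG [k Ck gk]] := cocompact_ultra H (U := U) Cq.
  have gu n := G_unit H (gG n).
  have hcv : h n *: p @[n --> U] --> (0 : E).
    by rewrite -(scale0r p); apply: cvgZl; exact: harmonic_ultra.
  have qcv : q n @[n --> U] --> e.
    by rewrite -[X in _ --> X]addr0; apply: cvgD => //; exact: cvg_cst.
  have [B zB] : exists B, \forall n \near U, `|invmx (g n)| <= B.
    apply: (bounded_at H (B := `|e| + 1) (C_sub H Ck) gk) => [n|].
      by apply: (G_presK H); exact: (G_inv H).
    by apply: filterS (cvg_norm_bounded qcv) => n; rewrite mulKmx.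
  have [T zT] := ultra_cvg_bounded zB.
  have [L L0 LP] := K_norm HO.
  have Kgv n : K (g n *m v) by exact: (G_presK H).
  have [w gw] : exists w : E, g n *m v @[n --> U] --> w.
    apply: (@ultra_cvg_bounded _ _ _ _ _ _ (fun n => g n *m v) (L * (s * (`|k| + 1)))).
    apply: filterS (cvg_norm_bounded gk) => n gn.
    apply: (@le_trans _ _ (L * `|s *: (g n *m q n)|)).
      apply: (LP _ _ (Kgv n)); rewrite scalemxAr -mulmxBr /q.
      apply: (G_presK H (gG n)); rewrite scalerDr addrAC; apply: (KD HO Ksv).
      by apply: (KZ HO); [exact: ltW|apply: (KZ HO); [exact: ltW|exact: poc_subK]].
    by rewrite ler_pM2l // normrZ gtr0_norm // ler_pM2l.
  have Kw : K w by apply: (closed_lim (@closed_closure _ O) _ gw); exact: filterE.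
  have Okw : O (k + t *: w).
    apply: (pocDK HO); first exact: (C_sub H).
    by apply: (KZ HO) => //; exact: ltW.
  have Tw : T *m (k + t *: w) = e + t *: v.
    rewrite mulmxDr -scalemxAr; congr (_ + _ *: _).
      apply: (mx_lim_unique (cvg_mulmx zT gk)).
      by under eq_fun do rewrite mulKmx //.
    apply: (mx_lim_unique (cvg_mulmx zT gw)).
    under eq_fun do rewrite mulKmx //.
    exact: cvg_cst.
  apply: (C_limit H Okw nO).
    apply/eqP => ev0; have : 0 < f (e + t *: v).
      rewrite linearD linearZ /= ltr_pwDl ?(Kf_gt0 HO) // mulr_ge0 ?(Kf_ge0 HO) //.
      exact: ltW.
    by rewrite ev0 linear0 ltxx.
  move=> z z0.
  have zTw : invmx (g n) *m (k + t *: w) @[n --> U] --> e + t *: v.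
    by rewrite -Tw; exact: (cvg_mulmx zT (cvg_cst _)).
  have /cvgrPdist_le/(_ z z0)/filter_ex[n zn] := zTw.
  by exists (invmx (g n)); [exact: (G_inv H)|rewrite distrC].
apply: (@closed_lim _ _ _ _ _ \oo _ (fun n => n.+1%:R^-1 *: e + v) _ (@closed_closure _ C)).
  apply: filterE => n; have n0 : 0 < (n.+1%:R : R) by rewrite ltr0n.
  have -> : n.+1%:R^-1 *: e + v = n.+1%:R^-1 *: (e + n.+1%:R *: v).
    by rewrite scalerDr scalerA mulVf ?scale1r // gt_eqF.
  by apply: (coneZ (C_cone H)); [rewrite invr_ge0 ltW|exact: far].
rewrite -[X in _ --> X]add0r -(scale0r e).
apply: cvgD; last exact: cvg_cst.
by apply: cvgZl; exact: cvg_harmonic.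
Qed.

Section FiniteFamily.
Variables (r : nat) (a : 'I_r -> 'M[R]_d).
Hypothesis Aa : forall j, A (a j).
Hypothesis Aspan : forall q, A q -> exists k : 'I_r -> R, q = \sum_j k j *: a j.

Let aA z : (forall j, z *m a j = a j *m z) -> forall b, A b -> z *m b = b *m z.
Proof.
move=> za q /Aspan[k ->]; rewrite mulmx_sumr mulmx_suml.
by apply: eq_bigr => j _; rewrite -scalemxAr -scalemxAl za.
Qed.

Let aeigen (v : E) (l : 'I_r -> R) : (forall j, a j *m v = l j *: v) ->
  forall q, A q -> exists t, q *m v = t *: v.
Proof.
move=> av q /Aspan[k ->]; exists (\sum_j k j * l j).
rewrite mulmx_suml scaler_suml; apply: eq_bigr => j _.
by rewrite -scalemxAl av scalerA.
Qed.

Variables (m : nat) (b : m.-tuple E).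
Local Notation V := (span b).
Hypothesis bF : forall i, fixed_vector (tnth b i).
Hypothesis FV : forall e, fixed_vector e -> e \in V.

Lemma centralizer_span z v : Z z -> v \in V -> z *m v \in V.
Proof.
move=> Zz vV; rewrite (coord_span vV) mulmx_sumr rpred_sum // => i _.
rewrite -scalemxAr memvZ //; apply: FV; apply: centralizer_fixed => //.
by rewrite -tnth_nth.
Qed.

Lemma bounded_displacement_sum (I : Type) (s : seq I) (P : pred I) (F : I -> E) :
  (forall i, P i -> fixed_vector (F i)) ->
  bounded_displacement O a (\sum_(i <- s | P i) F i).
Proof.
move=> FF; suff [] : K (\sum_(i <- s | P i) F i) /\
   bounded_displacement O a (\sum_(i <- s | P i) F i) by [].
apply: (big_ind (fun v => K v /\ bounded_displacement O a v)).
- split; first exact: (K0 HO).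
  by exists (fun=> 1), (fun=> 1); split=> //; exact: displaced0 H _ _ _ _.
- move=> u v [Ku Bu] [Kv Bv]; split; first exact: (KD HO).
  exact: (bounded_displacementD H).
- move=> i /FF[Ci i0 ai]; have Ki := C_subK H Ci; split=> //.
  by apply: (bounded_displacement_eigen H AG Aa) => // j; exact: ai.
Qed.

(** Degenerate towards the sum h of the eigenvectors that span V.  If V missed
    the core, x would be nonzero, and the cone of the vectors of the closure of
    C killed by T would contain a common eigenvector.  It lies in V, where T is
    injective because h is interior to the closure of C inside V. *)
Lemma fixed_span_meets : exists v, v \in V /\ C v.
Proof.
have [p Cp] := C_neq0 H.
pose h := \sum_i tnth b i.
have Ch : closure C h by apply: (cone_sum _ (C_cone H)) => i _; have [] := bF i.
have Bh : bounded_displacement O a h by exact: bounded_displacement_sum.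
have [U [UU [z [T [y [x [[zZ zT [Cy zy] Ck Cx] [Ty Tx]]]]]]]] :=
  degeneration H AG Aa aA Ch Bh Cp.
have hV : h \in V by apply: rpred_sum => i _; exact: FV.
have yV : y \in V.
  apply: (subspace_cvg _ zy); apply: filterE => n.
  by apply: centralizer_span => //; exact: (centralizer_inv H).
have [x0|x0] := eqVneq x 0; first by exists y; split=> //; rewrite x0 addr0 in Ck.
pose J := closure C `&` [set v | T *m v = 0].
have TA q : A q -> T *m q = q *m T.
  move=> Aq; apply: (lim_commute _ zT) => n; have [_] := zZ n; exact.
have [e [[Ce Te] e0 eA]] : exists e, [/\ J e, e != 0 & forall q, A q -> exists l, q *m e = l *: e].
  apply: (@common_eigenvector _ _ f c) => //.
  - exact: poc_c HO.
  - split=> [|u v [Cu Tu] [Cv Tv]|t v t0 [Cv Tv]]; split; rewrite /=.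
    + exact: (cone0 (C_cone H)).
    + by rewrite mulmx0.
    + exact: (coneD (C_cone H)).
    + by rewrite mulmxDr Tu Tv addr0.
    + exact: (coneZ (C_cone H)).
    + by rewrite -scalemxAr Tv scaler0.
  - apply: closedI; first exact: closed_closure.
    rewrite (_ : [set v | _] = [set v | v \in lker (linfun (mulmx T))]).
      exact: subspace_closed.
    by apply/seteqP; split=> v /=; rewrite memv_ker lfunE /= => /eqP.
  - by move=> v [Cv _]; apply: (Kf HO); exact: (C_subK H).
  - by exists x.
  - move=> q Aq v [Cv Tv]; split; first by apply: preserves_closure Cv; apply: (C_pres H); exact: AG.
    by rewrite /= mulmxA TA // -mulmxA Tv mulmx0.
have eV : e \in V by apply: FV; split.
pose J' := closure C `&` [set v | v \in V].
have J'c : convex_cone J'.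
  split=> [|u v [Cu uV] [Cv vV]|t v t0 [Cv vV]]; split; rewrite /=.
  + exact: (cone0 (C_cone H)).
  + exact: mem0v.
  + exact: (coneD (C_cone H)).
  + exact: rpredD.
  + exact: (coneZ (C_cone H)).
  + exact: memvZ.
have [t t0 tP] := span_order_unit J'c (fun i => conj (let: And3 x _ _ := bF i in x) (FV (bF i))).
have J'z w : Z w -> preserves w J'.
  move=> Zw v [Cv vV]; split; last exact: centralizer_span.
  by apply: preserves_closure Cv; apply: (C_pres H); case: Zw.
have inj : forall v, v \in V -> J' (T *m v) -> J' v.
  apply: (degeneration_injective H _ zT J'c _ _ _ _ _ t0 tP _ Ty) => //.
  - by move=> n; apply: (G_unit H); case: (zZ n).
  - by apply: closedI; [exact: closed_closure|exact: subspace_closed].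
  - by move=> v [/(C_subK H)].
  - by move=> v [].
  - by move=> n; exact: J'z.
  - by move=> n; apply: J'z; exact: (centralizer_inv H).
have [||CNe _] := inj (- e); first by rewrite memvN.
  by rewrite mulmxN Te oppr0; exact: cone0 J'c.
by move/eqP: e0; case; apply: (K_pointed HO); exact: (C_subK H).
Qed.


Variable chi : 'I_m -> 'I_r -> R.
Hypothesis bchi : forall i j, a j *m tnth b i = chi i j *: tnth b i.

(** Degenerate towards the sum e of eigenvectors that span the part of V with
    the character of i0.  The limit T kills the eigenvectors with another
    character, because it sends them below a multiple of e.  So T takes the
    same value at q and at its component, which [degeneration_injective] then
    puts in K and [face_in_core] in the closure of C. *)
Lemma eigen_component (i0 : 'I_m) q : q \in V -> K q ->
  closure C (\sum_(i | [forall j, chi i j == chi i0 j]) coord b i q *: tnth b i).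
Proof.
move=> qV Kq; set P := fun i => [forall j, chi i j == chi i0 j].
pose F0 := [set e | fixed_vector e /\ forall j, a j *m e = chi i0 j *: e].
have F0Z z e : Z z -> F0 e -> F0 (z *m e).
  move=> Zz [Fe ae]; split; first exact: centralizer_fixed.
  by move=> j; have [_ zA] := Zz; rewrite mulmxA -zA // -mulmxA ae scalemxAr.
have bF0 i : P i -> F0 (tnth b i).
  by move=> /forallP Pi; split=> // j; rewrite bchi (eqP (Pi j)).
have [s [sF sspan]] := spanning_seq F0.
pose w := in_tuple s; pose W := span w.
have wF i : F0 (tnth w i) by apply: sF; exact: mem_tnth.
have WZ z v : Z z -> v \in W -> z *m v \in W.
  move=> Zz vW; rewrite (coord_span vW) mulmx_sumr rpred_sum // => i _.
  rewrite -scalemxAr memvZ //; apply: sspan; apply: F0Z => //.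
  by rewrite -tnth_nth.
pose e := \sum_i tnth w i.
have eW : e \in W by apply: rpred_sum => i _; exact: sspan.
have Ce : closure C e by apply: (cone_sum _ (C_cone H)) => i _; have [[]] := wF i.
have ae j : a j *m e = chi i0 j *: e.
  by rewrite mulmx_sumr scaler_sumr; apply: eq_bigr => i _; have [_] := wF i.
pose J := K `&` [set v | v \in W].
have Jc : convex_cone J.
  split=> [|u v [Cu uV] [Cv vV]|t v t0 [Cv vV]]; split; rewrite /=.
  + exact: (K0 HO).
  + exact: mem0v.
  + exact: (KD HO).
  + exact: rpredD.
  + exact: (KZ HO).
  + exact: memvZ.
have Jcl : closed J by apply: closedI; [exact: closed_closure|exact: subspace_closed].
have wJ i : J (tnth w i).
  by split; [apply: (C_subK H); have [[]] := wF i|exact: sspan].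
have [t t0 tP] := span_order_unit Jc wJ.
have dom v : v \in W -> exists2 q0 : R, 0 < q0 & K (q0 *: e - v).
  move=> vW; pose q0 := (1 + `|v|) / t.
  have q00 : 0 < q0 by rewrite divr_gt0 // ltr_pwDl.
  exists q0 => //; have -> : q0 *: e - v = q0 *: (e - q0^-1 *: v).
    by rewrite scalerBr scalerA mulfV ?scale1r // gt_eqF.
  apply: (KZ HO); first exact: ltW.
  have [] // := tP (q0^-1 *: v); first by rewrite memvZ.
  rewrite normrZ gtr0_norm ?invr_gt0 // invf_div mulrAC ler_pdivrMr ?ltr_pwDl //.
  by rewrite ler_pM2l // lerDr.
have e0 : e != 0.
  apply/eqP => e0.
  have [q0 q00] := dom _ (sspan _ (bF0 i0 (ltac:(by apply/forallP)))).
  rewrite e0 scaler0 sub0r => KN; have [Ci /eqP + _] := bF i0; apply.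
  by apply: (K_pointed HO) => //; exact: (C_subK H).
have Fe : fixed_vector e by split=> //; exact: aeigen.
have [p Cp] := C_neq0 H.
have Be : bounded_displacement O a e.
  by apply: (bounded_displacement_eigen H AG Aa (C_subK H Ce) e0) => j; exists (chi i0 j).
have [U [UU [z [T [y [x [[zZ zT [Cy zy] Ck Cx] [Ty Tx]]]]]]]] :=
  degeneration H AG Aa aA Ce Be Cp.
have zu n : z n \in unitmx by apply: (G_unit H); case: (zZ n).
have zJ q0 : Z q0 -> preserves q0 J.
  by move=> Zq v [Kv vW]; split; [apply: (G_presK H) => //; case: Zq|exact: WZ].
have yW : y \in W.
  apply: (subspace_cvg _ zy); apply: filterE => n.
  by apply: WZ => //; exact: (centralizer_inv H).
have TK : preserves T K.
  by apply: (lim_preserves _ _ zT); [exact: closed_closure|move=> n; apply: (G_presK H); case: (zZ n)].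
have TW v : v \in W -> T *m v \in W.
  apply: (lim_preserves (J := [set v | v \in W]) _ _ zT); first exact: subspace_closed.
  by move=> n u; exact: WZ.
have TA j : T *m a j = a j *m T.
  by apply: (lim_commute _ zT) => n; have [_] := zZ n; exact.
have Tb i : ~~ P i -> T *m tnth b i = 0.
  rewrite negb_forall => /existsP[j ij]; have [Ci i0' _] := bF i.
  have Ki := C_subK H Ci.
  have [q0 q00 Oq] := poc_dominates HO (tnth b i) (C_sub H Ck).
  apply: (@eigen_dominated (a j) e _ (chi i0 j) (chi i j) q0) => //.
  - exact: AG.
  - exact: (C_subK H).
  - exact: TK.
  - by rewrite mulmxA -TA -mulmxA bchi scalemxAr.
  - by rewrite eq_sym.
  - by have := TK _ (poc_subK Oq); rewrite mulmxBr -scalemxAr mulmxDr Ty Tx addr0.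
set pq := \sum_(i | _) _.
have pW : pq \in W.
  by apply: rpred_sum => i Pi; rewrite memvZ //; apply: sspan; exact: bF0.
have Tq : T *m q = T *m pq.
  rewrite {1}(coord_span qV) (bigID P) /= mulmxDr [X in _ + X](_ : _ = 0) ?addr0.
    by congr (_ *m _); apply: eq_bigr => i _; rewrite -tnth_nth.
  rewrite mulmx_sumr big1 // => i nPi.
  by rewrite -tnth_nth -scalemxAr Tb // scaler0.
have Kpq : K pq.
  have [] // : J pq.
  apply: (degeneration_injective H zu zT Jc Jcl _ _ _ _ t0 tP _ Ty) => //.
  - by move=> v [].
  - by move=> v [].
  - by move=> n; exact: zJ.
  - by move=> n; apply: zJ; exact: (centralizer_inv H).
  - by split=> //; exact: (C_subK H).
  - by split; [rewrite -Tq; exact: TK|exact: TW].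
have [q0 q00 Kq0] := dom _ pW.
exact: (face_in_core Ce (fixed_vector_boundary Fe) Kpq q00 Kq0).
Qed.

(** By [eigen_component] a vector of K in V is a sum of vectors of the closure
    of C on which the a j act by characters. *)
Lemma span_displaced : exists al be, (forall j, 0 < al j) /\
  forall q, q \in V -> K q -> closure C q /\ displaced O a al be q.
Proof.
have chi0 i j : 0 < chi i j.
  have [Ci i0 _] := bF i.
  by apply: (eigen_gt0 H _ (C_subK H Ci) i0 (bchi i j)); exact: AG.
pose al j := (1 + \sum_i (chi i j)^-1)^-1; pose be j := \sum_i chi i j.
have S0 j : 0 < 1 + \sum_i (chi i j)^-1.
  by rewrite ltr_pwDl // sumr_ge0 // => i _; rewrite invr_ge0 ltW.
have al0 j : 0 < al j by rewrite invr_gt0.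
have chi_al i j : al j <= chi i j.
  rewrite -[chi i j]invrK lef_pV2 ?posrE ?invr_gt0 // (bigD1 i) //= addrCA lerDl.
  by rewrite addr_ge0 // sumr_ge0 // => i' _; rewrite invr_ge0 ltW.
have chi_be i j : chi i j <= be j.
  by rewrite /be (bigD1 i) //= lerDl sumr_ge0 // => i' _; exact: ltW.
exists al, be; split=> // q qV Kq.
(* [rep] chooses an index in each class of indices with the same character. *)
pose eqc i i' := [forall j, chi i' j == chi i j].
pose rep i := odflt i [pick i' | eqc i i'].
have repP i : eqc i (rep i).
  by rewrite /rep; case: pickP => [//|/(_ i)] /=; rewrite /eqc; case: forallP.
have repE i i' : (rep i' == rep i) = eqc i i'.
  apply/eqP/idP => [e|/forallP e].
    apply/forallP => j; have /forallP/(_ j) := repP i'; rewrite e => /eqP <-.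
    by have /forallP/(_ j) := repP i.
  have e' : eqc i =1 eqc i'.
    by move=> k; apply: eq_forallb => j; have /eqP-> := e j.
  rewrite /rep -(eq_pick e'); case: pickP => //= /(_ i').
  by rewrite e' /eqc; case: forallP.
suff [] : closure C q /\ displaced O a al be q by [].
rewrite (coord_span qV) (partition_big rep xpredT) //=.
apply: (big_ind (fun v => closure C v /\ displaced O a al be v)).
- by split; [exact: cone0 (C_cone H)|exact: displaced0 H _ _ _ _].
- move=> u v [Cu Du] [Cv Dv]; split; first exact: coneD (C_cone H) _ _ _ _.
  exact: (displacedD H).
move=> k _; have [[i0 /eqP ki0]|no] := pselect (exists i, rep i == k); last first.
  rewrite big_pred0 => [|i]; last by apply/negP => ik; apply: no; exists i.
  by split; [exact: cone0 (C_cone H)|exact: displaced0 H _ _ _ _].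
rewrite -ki0; have Ck := @eigen_component i0 q qV Kq.
have -> : \sum_(i < m | rep i == rep i0) coord b i q *: b`_i =
    \sum_(i | [forall j, chi i j == chi i0 j]) coord b i q *: tnth b i.
  by apply: eq_big => [i|i _]; [rewrite repE|rewrite -tnth_nth].
split=> //; set v := \sum_(i | _) _ in Ck *.
apply: (@displaced_weaken _ _ _ _ _ _ _ H _ a (chi i0) (chi i0)) => //.
  exact: (C_subK H).
move=> j; have -> : a j *m v = chi i0 j *: v.
  rewrite mulmx_sumr scaler_sumr; apply: eq_bigr => i /forallP/(_ j)/eqP <-.
  by rewrite -scalemxAr bchi !scalerA mulrC.
by rewrite subrr; split; exact: (K0 HO).
Qed.

Lemma centralizer_cocompact_span (I : Type) (U : set_system I) {UU : UltraFilter U}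
    (x : I -> E) : (forall i, x i \in V) -> (forall i, O (x i)) ->
  exists2 z : I -> 'M[R]_d, (forall i, Z (z i)) &
    exists2 k, k \in V /\ O k & z i *m x i @[i --> U] --> k.
Proof.
move=> xV xO; have [al [be [al0 D]]] := span_displaced.
have xK i : K (x i) by exact: poc_subK.
have Cx i : C (x i) by apply: (C_closed H) => //; have [] := D _ (xV i) (xK i).
have Dx i : displaced O a al be (x i) by have [] := D _ (xV i) (xK i).
have [z zZ [k Ck zk]] := centralizer_cocompact H AG (U := U) Aa aA al0 Cx Dx.
exists z => //; exists k => //; split; last exact: (C_sub H).
apply: (subspace_cvg _ zk); apply: filterE => i; exact: centralizer_span.
Qed.

End FiniteFamily.

End FixedCone.

Local Open Scope quotient_scope.

(** * Cones over subsets of projective space *)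

Lemma convex_setP (R : realType) (E : lmodType R) (A : set E) :
  convex_set A <-> forall x y (t : R), A x -> A y -> 0 <= t -> t <= 1 ->
    A (t *: x + (1 - t) *: y).
Proof.
split=> [cA x y t Ax Ay t0 t1|cA x y t /set_mem Ax /set_mem Ay].
  by have := cA x y (Itv01 t0 t1) (mem_set Ax) (mem_set Ay) => /set_mem.
by apply: mem_set; apply: cA.
Qed.

Section ProjectiveCones.
Variables (R : realType) (d : nat).
Local Notation E := 'cV[R]_d.
Local Notation P := (projspace R d).
Local Notation pj w := (\pi_(projspace R d) w).
Implicit Types (X : set P) (f : {scalar E}) (w : nzvec R d).

Definition mknz (v : E) (v0 : v != 0) : nzvec R d :=
  exist _ v (mem_set (v0 : [set u : E | u != 0] v)).

Lemma pi_scale w w' s : s != 0 -> val w' = s *: val w -> (pj w') = (pj w).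
Proof. by move=> s0 e; apply/esym/eq_projP; exists s. Qed.

Definition cone_over f X : set E :=
  [set val w | w in [set w | X (pj w) /\ 0 < f (val w)]].

Lemma cone_overP f X w : cone_over f X (val w) <-> X (pj w) /\ 0 < f (val w).
Proof. by split=> [[w' H /val_inj <-]|H]; [|exists w]. Qed.

Lemma cone_over_scale f X s v : 0 < s -> cone_over f X v -> cone_over f X (s *: v).
Proof.
move=> s0 [w [Xw fw] <-].
have sw : s *: val w != 0 by rewrite scaler_eq0 negb_or gt_eqF // nzvec_neq0.
exists (mknz sw) => //; split; last by rewrite linearZ /= mulr_gt0.
by rewrite (@pi_scale w _ s) // gt_eqF.
Qed.

Lemma cone_over_add f X u v : convex_set (chart_image f X) ->
  cone_over f X u -> cone_over f X v -> cone_over f X (u + v).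
Proof.
move=> /convex_setP Xc Xu Xv.
have chart z : cone_over f X z -> 0 < f z /\ chart_image f X ((f z)^-1 *: z).
  move=> Xz; have fz : 0 < f z by case: Xz => w [? ?] <-.
  split=> //; have [|w [Xw fw] e] := @cone_over_scale f X (f z)^-1 z _ Xz.
    by rewrite invr_gt0.
  by exists w => //; split=> //; rewrite e linearZ /= mulVf // gt_eqF.
have [fu Cu] := chart _ Xu; have [fv Cv] := chart _ Xv.
have s0 : 0 < f u + f v by rewrite addr_gt0.
have t0 : 0 <= f u / (f u + f v) by rewrite divr_ge0 // ltW.
have t1 : f u / (f u + f v) <= 1 by rewrite ler_pdivrMr // mul1r lerDl ltW.
have [w [Xw fw] e] := Xc _ _ _ Cu Cv t0 t1.
have -> : u + v = (f u + f v) *: val w.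
  have nu : f u != 0 by rewrite gt_eqF.
  have nv : f v != 0 by rewrite gt_eqF.
  have ns : f u + f v != 0 by rewrite gt_eqF.
  rewrite e scalerDr !scalerA; move: (f u) (f v) nu nv ns => p q nu nv ns.
  rewrite [X in _ = X *: _ + _](_ : _ = 1); last by field; apply/andP.
  rewrite [X in _ = _ + X *: _](_ : _ = 1); last by field; apply/andP.
  by rewrite !scale1r.
by apply: cone_over_scale => //; apply/cone_overP; rewrite fw.
Qed.

Lemma in_chart_sign f X w : in_chart f X -> X (pj w) ->
  cone_over f X (val w) \/ cone_over f X (- val w).
Proof.
move=> Xf Xw; have := Xf _ Xw; rewrite neq_lt => /orP[fw|fw]; last first.
  by left; apply/cone_overP.
right; have nw : - val w != 0 by rewrite oppr_eq0 nzvec_neq0.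
rewrite -[- val w]/(val (mknz nw)); apply/cone_overP; split; last first.
  by rewrite /= linearN oppr_gt0.
by rewrite (@pi_scale w _ (-1)) ?oppr_eq0 ?oner_eq0 //= scaleN1r.
Qed.

Lemma nz_openP (B : set (nzvec R d)) : open B <-> exists2 D : set E, open D & val @^-1` D = B.
Proof. by split=> -[D]; exists D. Qed.

Lemma pi_proj_continuous : continuous (fun w : nzvec R d => (pj w)).
Proof. exact: pi_continuous. Qed.

Lemma proj_open (D : set E) : open D -> open [set (pj w) | w in [set w | D (val w)]].
Proof.
move=> oD; rewrite /open /= /quotient_open /=.
rewrite (_ : _ @^-1` _ = \bigcup_(s in [set s : R | s != 0]) (val @^-1` ((fun v => s *: v) @^-1` D))).
  apply: bigcup_open => s _; apply/nz_openP.
  exists ((fun v => s *: v) @^-1` D) => //.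
  apply: open_comp => // v _; exact: (@scaler_continuous _ E s v).
apply/seteqP; split=> [w [w' Dw' /eq_projP[s s0 e]]|w [s s0 Dw]].
  exists s^-1; first by rewrite /= invr_eq0.
  by rewrite /= e scalerA mulVf // scale1r.
have sw : s *: val w != 0 by rewrite scaler_eq0 negb_or s0 nzvec_neq0.
by exists (mknz sw) => //; exact: (@pi_scale w _ s).
Qed.

Lemma nbhs_proj w (N : set P) : nbhs (pj w) N ->
  exists2 e : R, 0 < e & forall w', `|val w - val w'| <= e -> N (pj w').
Proof.
move=> /pi_proj_continuous; rewrite /= nbhs_filterE nbhsE /= => -[B [/nz_openP[D oD <-] Dw] BN].
have /nbhs_closedballP[e eD] : nbhs (val w) D by exact: open_nbhs_nbhs.
exists e%:num => // w' ww'; apply: (BN w'); apply: eD.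
by rewrite closed_ballE.
Qed.

Lemma GLact_continuous (M : GL R d) : continuous (GLact M).
Proof.
apply/continuousP => B /nz_openP[D oD <-]; apply/nz_openP.
exists ((fun v => val M *m v) @^-1` D) => //.
apply: open_comp => // v _.
by apply: (@cvg_mulmx R _ (nbhs v) _ d d 1 (fun=> val M) id); [exact: cvg_cst|exact: cvg_id].
Qed.

Lemma pact_continuous (g : PGL R d) : continuous (pact g).
Proof.
apply/quotient_continuous; rewrite -[g]reprK.
rewrite (_ : _ \o _ = (fun w : nzvec R d => (pj w)) \o GLact (repr g)).
  move=> w; apply: continuous_comp; [exact: GLact_continuous|exact: pi_proj_continuous].
by apply/funext => w /=; rewrite pact_pi.
Qed.

End ProjectiveCones.

(** * The cone over a properly convex domain *)

Section Subgroups.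
Variables (gT : groupType) (H : set gT).
Hypothesis HH : is_subgroup H.

Lemma subgroup1 : H 1%g.
Proof. by case: HH => + _; rewrite inE. Qed.

Lemma subgroupV g : H g -> H g^-1%g.
Proof. by move=> /mem_set/(group_closedV HH)/set_mem. Qed.

Lemma subgroupM g h : H g -> H h -> H (g * h)%g.
Proof. by move=> /mem_set Hg /mem_set Hh; have /set_mem := group_closedM HH Hg Hh. Qed.

End Subgroups.

Section ClosureLifts.
Variables (R : realType) (d : nat) (f : {scalar 'cV[R]_d}) (X : set (projspace R d)).
Local Notation E := 'cV[R]_d.
Local Notation pj w := (\pi_(projspace R d) w).

Lemma closure_cone_over w : closure (cone_over f X) (val w) -> closure X (pj w).
Proof.
move=> /closureP Xw N /nbhs_proj[e e0 eN].
have [_ [w' [Xw' _] <-] ww'] := Xw _ e0.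
by exists (pj w'); split=> //; exact: eN.
Qed.

Lemma closure_lift w : in_chart f X -> closure X (pj w) ->
  closure (cone_over f X) (val w) \/ closure (cone_over f X) (- val w).
Proof.
move=> Xf Xw; apply: contrapT => /not_orP[n1 n2].
have far v : ~ closure (cone_over f X) v ->
    exists2 e : R, 0 < e & forall u, cone_over f X u -> e < `|v - u|.
  move=> nv; apply: contrapT => ne; apply: nv; apply/closureP => e e0.
  apply: contrapT => nu; apply: ne; exists e => // u Xu; rewrite ltNge.
  by apply/negP => ue; apply: nu; exists u.
have [e1 e10 e1P] := far _ n1; have [e2 e20 e2P] := far _ n2.
pose e := Num.min e1 e2; have e0 : 0 < e by rewrite lt_min e10.
have oB : open (ball (val w) e) by exact: ball_open.
have nB : nbhs (pj w) [set pj w' | w' in [set w' : nzvec R d | ball (val w) e (val w')]].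
  apply: open_nbhs_nbhs; split; first exact: proj_open oB.
  by exists w => //; exact: ballxx.
have [x [Xx [w' ww' xE]]] := Xw _ nB; rewrite -xE in Xx.
have {}ww' : ball (val w) e (val w') := ww'.
rewrite -ball_normE in ww'; have {ww'} /andP[w1 w2] : (`|val w - val w'| < e1) && (`|val w - val w'| < e2).
  by rewrite -lt_min.
have [Xw'|Xw'] := in_chart_sign Xf Xx.
  by have := lt_trans w1 (e1P _ Xw'); rewrite ltxx.
have := lt_trans w2 (e2P _ Xw').
by rewrite -opprD normrN ltxx.
Qed.

End ClosureLifts.

Section Domain.
Variables (R : realType) (d : nat) (Omega : set (projspace R d)) (f : {scalar 'cV[R]_d}).
Local Notation E := 'cV[R]_d.
Local Notation pj w := (\pi_(projspace R d) w).
Hypotheses (Oopen : open Omega) (Ochart : in_chart f Omega)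
  (Oconv : convex_set (chart_image f Omega)) (Obd : bounded_set (chart_image f Omega))
  (Oneq0 : Omega !=set0).
Local Notation O := (cone_over f Omega).

Lemma domain_cone_pos v : O v -> 0 < f v.
Proof. by case=> w [_ fw] <-. Qed.

Lemma domain_proper_cone : exists c, proper_open_cone O f c.
Proof.
have [M [Mr MP]] := Obd.
pose m := Num.max M 0 + 1.
have m0 : 0 < m by rewrite ltr_wpDl // le_max lexx orbT.
exists m^-1; split.
- rewrite (_ : O = [set v | 0 < f v] `&` \bigcup_(D in [set D : set E | open D /\ val @^-1` D = (fun w : nzvec R d => pj w) @^-1` Omega]) D).
    apply: openI; last by apply: bigcup_open => D [].
    apply: open_comp (@open_gt R 0) => v _.
    by apply: (linear_cvg f (F := nbhs v) (u := id)); exact: cvg_id.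
  apply/seteqP; split=> [_ [w [Ow fw] <-]|v [/= fv [D [oD DO] Dv]]].
    split=> //; have /nz_openP[D oD DO] : open ((fun w : nzvec R d => pj w) @^-1` Omega).
      by apply: open_comp => // ? _; exact: pi_proj_continuous.
    by exists D => //; have : (val @^-1` D) w by rewrite DO.
  have v0 : v != 0 by apply/eqP => v0; rewrite v0 linear0 ltxx in fv.
  rewrite -[v]/(val (mknz v0)); apply/cone_overP; split=> //.
  by have : (val @^-1` D) (mknz v0) by []; rewrite DO.
- have [x Ox] := Oneq0; rewrite -[x]reprK in Ox.
  by have [|] := in_chart_sign Ochart Ox; [exists (val (repr x))|exists (- val (repr x))].
- by move=> u v; exact: cone_over_add.
- by move=> t v; exact: cone_over_scale.
- by rewrite invr_gt0.
- exact: domain_cone_pos.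
- move=> v Ov; have fv := domain_cone_pos Ov.
  have [|w [Ow fw] e] := @cone_over_scale _ _ f Omega (f v)^-1 v _ Ov.
    by rewrite invr_gt0.
  have : `|val w| <= m.
    apply: (MP m); first by rewrite ltr_pwDr // le_max lexx.
    by exists w => //; split=> //; rewrite e linearZ /= mulVf // gt_eqF.
  by rewrite e normrZ gtr0_norm ?invr_gt0 // ler_pdivrMl // ler_pdivrMl // mulrC.
Qed.

Variable c : R.
Hypothesis HO : proper_open_cone O f c.
Local Notation K := (closure O).

Lemma domain_sign w : closure Omega (pj w) -> K (val w) \/ K (- val w).
Proof. exact: closure_lift. Qed.

(** The chart that makes X convex need not be that of f.  If its functional g
    had opposite signs at w1 and w2, then the segment of X between them would
    contain a point where f vanishes, and there is none in the closure of
    Omega. *)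
Lemma proj_convex_add X w1 w2 w3 : proj_convex X -> X `<=` closure Omega ->
  K (val w1) -> K (val w2) -> X (pj w1) -> X (pj w2) -> val w3 = val w1 + val w2 ->
  X (pj w3).
Proof.
move=> [g [_ Xg /convex_setP Xc]] XO K1 K2 X1 X2 e.
have inv w : X (pj w) -> chart_image g X ((g (val w))^-1 *: val w).
  move=> Xw; have gw := Xg _ Xw.
  have nz : (g (val w))^-1 *: val w != 0.
    by rewrite scaler_eq0 negb_or invr_eq0 gw nzvec_neq0.
  exists (mknz nz) => //; split; last by rewrite /= linearZ /= mulVf.
  by rewrite (@pi_scale _ _ w _ (g (val w))^-1) ?invr_eq0.
have C1 := inv _ X1; have C2 := inv _ X2.
have g1 := Xg _ X1; have g2 := Xg _ X2.
have f1 : 0 < f (val w1) by apply: (Kf_gt0 HO) => //; exact: nzvec_neq0.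
have f2 : 0 < f (val w2) by apply: (Kf_gt0 HO) => //; exact: nzvec_neq0.
have [same|opp] := ltP 0 (g (val w1) * g (val w2)).
  pose t := g (val w1) / (g (val w1) + g (val w2)).
  have t01 : [/\ 0 <= t, t <= 1 & g (val w1) + g (val w2) != 0].
    rewrite /t; move: g1 same; rewrite neq_lt => /orP[g1|g1].
      rewrite nmulr_rgt0 // => g2'; have s0 : g (val w1) + g (val w2) < 0 by lra.
      split; last by rewrite lt_eqF.
        by rewrite -mulrNN -invrN divr_ge0 // oppr_ge0 ltW.
      by rewrite ler_ndivrMr // mul1r gerDl ltW.
    rewrite pmulr_rgt0 // => g2'; have s0 : 0 < g (val w1) + g (val w2) by lra.
    split; last by rewrite gt_eqF.
      by rewrite divr_ge0 // ltW.
    by rewrite ler_pdivrMr // mul1r lerDl ltW.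
  have [t0 t1 s0] := t01.
  have [w [Xw gw] we] := Xc _ _ _ C1 C2 t0 t1.
  rewrite (@pi_scale _ _ w _ (g (val w1) + g (val w2))) //.
  rewrite e we scalerDr !scalerA /t; move: (g (val w1)) (g (val w2)) g1 g2 s0 => p q g1 g2 s0.
  rewrite [X in _ = X *: _ + _](_ : _ = 1); last by field; apply/andP.
  rewrite [X in _ = _ + X *: _](_ : _ = 1); last by field; apply/andP.
  by rewrite !scale1r.
exfalso; pose p := f (val w1) / `|g (val w1)|; pose q := f (val w2) / `|g (val w2)|.
have p0 : 0 < p by rewrite divr_gt0 // normr_gt0.
have q0 : 0 < q by rewrite divr_gt0 // normr_gt0.
have pq0 : 0 < p + q by rewrite addr_gt0.
have t0 : 0 <= q / (p + q) by rewrite divr_ge0 // ltW.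
have t1 : q / (p + q) <= 1 by rewrite ler_pdivrMr // mul1r lerDr ltW.
have [w [Xw gw] we] := Xc _ _ _ C1 C2 t0 t1.
have fw : f (val w) = 0.
  have fZ (s : R) (v : E) : f (s *: v) = s * f v by rewrite linearZ.
  rewrite we linearD !fZ.
  have pq_neq0 : p + q != 0 by rewrite gt_eqF.
  have [[-> ->]|[-> ->]] : ((g (val w1))^-1 * f (val w1) = p /\ (g (val w2))^-1 * f (val w2) = - q) \/
      ((g (val w1))^-1 * f (val w1) = - p /\ (g (val w2))^-1 * f (val w2) = q).
    rewrite /p /q ![_^-1 * _]mulrC; move: g1 opp; rewrite neq_lt => /orP[g1|g1].
      rewrite nmulr_rle0 // le_eqVlt eq_sym (negbTE g2) /= => g2'.
      by right; rewrite (ltr0_norm g1) (gtr0_norm g2') invrN mulrN opprK.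
    rewrite pmulr_rle0 // le_eqVlt (negbTE g2) /= => g2'.
    by left; rewrite (gtr0_norm g1) (ltr0_norm g2') invrN mulrN opprK.
    by field.
  by field.
have [Kw|Kw] := domain_sign (XO _ Xw).
  by have := Kf_gt0 HO Kw (nzvec_neq0 w); rewrite fw ltxx.
have := Kf_gt0 HO Kw; rewrite oppr_eq0 linearN fw oppr0 ltxx => /(_ (nzvec_neq0 w)).
by [].
Qed.

End Domain.

(** * Lifts of projective automorphisms *)

Section Lifts.
Variables (R : realType) (d : nat) (Omega : set (projspace R d)) (f : {scalar 'cV[R]_d}).
Local Notation E := 'cV[R]_d.
Local Notation pj w := (\pi_(projspace R d) w).
Local Notation pg g := (\pi_(PGL R d) g).
Hypothesis Ochart : in_chart f Omega.
Local Notation O := (cone_over f Omega).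
Variable c : R.
Hypothesis HO : proper_open_cone O f c.
Local Notation K := (closure O).

Lemma pgM g h : (pg g * pg h)%g = pg (GLM g h). Proof. exact: PGLM_pi. Qed.
Lemma pgV g : (pg g)^-1%g = pg (GLV g). Proof. exact: PGLV_pi. Qed.
Lemma pg1 : pg (GL1 R d) = 1%g. Proof. by []. Qed.

Lemma autE (g : PGL R d) x : proj_Aut Omega g -> Omega (pact g x) <-> Omega x.
Proof.
move=> gO; split=> [Ox|Ox]; last by rewrite -gO; exists x.
have : (pact g @` Omega) (pact g x) by rewrite gO.
move=> [y Oy e]; suff -> : x = y by [].
by rewrite -[x]pact1 -(mulVg g) pactM -e -pactM mulVg pact1.
Qed.

Definition GLN (g : GL R d) : GL R d.
Proof. by apply: (@mkGL _ _ (- val g)); rewrite -scaleN1r unitmxZ ?Defs.GL_unit // unitrN unitr1. Defined.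

Lemma pgN g : pg (GLN g) = pg g.
Proof. by apply/esym/eq_PGLP; exists (-1); rewrite ?oppr_eq0 ?oner_eq0 //= scaleN1r. Qed.

Lemma lift_nz g v : proj_Aut Omega (pg g) -> O v -> f (val g *m v) != 0.
Proof.
move=> gO [w [Ow fw] <-].
apply: (Ochart (w := GLact g w)).
by rewrite -pact_pi; apply/autE.
Qed.

Lemma preservesP g : proj_Aut Omega (pg g) ->
  preserves (val g) O <-> forall v, O v -> 0 < f (val g *m v).
Proof.
move=> gO; split=> [gP v /gP|gP _ [w [Ow fw] <-]]; first exact: (poc_pos HO).
rewrite -[_ *m _]/(val (GLact g w)); apply/cone_overP; split.
  by rewrite -pact_pi; apply/autE.
by apply: gP; apply/cone_overP.
Qed.

(** As v runs over the convex cone O, the number f (g v) never vanishes, so its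
    sign is constant: g or - g preserves O. *)
Lemma lift_exists (h : PGL R d) : proj_Aut Omega h ->
  exists2 g : GL R d, pg g = h & preserves (val g) O.
Proof.
move=> hO; pose g := repr h; have gh : pg g = h by exact: reprK.
have gO : proj_Aut Omega (pg g) by rewrite gh.
have [pos|/existsNP[v /not_implyP[Ov /negP nv]]] :=
  pselect (forall v, O v -> 0 < f (val g *m v)).
  by exists g => //; apply/preservesP.
have fv : f (val g *m v) < 0 by rewrite lt_neqAle lift_nz //= leNgt.
exists (GLN g); first by rewrite pgN.
apply/preservesP; first by rewrite pgN.
move=> u Ou; rewrite /= mulNmx linearN oppr_gt0 lt_neqAle lift_nz //=.
rewrite leNgt; apply/negP => fu.
pose w := f (val g *m u) *: v - f (val g *m v) *: u.
have Ow : O w.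
  by rewrite /w -scaleNr; apply: (pocD HO); apply: (pocZ HO); rewrite ?oppr_gt0.
have := lift_nz gO Ow; have fZ (s : R) (x : E) : f (s *: x) = s * f x by rewrite linearZ.
by rewrite mulmxBr -!scalemxAr linearB !fZ mulrC subrr eqxx.
Qed.

Definition lifts (X : set (PGL R d)) : set 'M[R]_d :=
  [set val g | g in [set g : GL R d | X (pg g) /\ preserves (val g) O]].

Lemma lifts_commute M N (g h : GL R d) : val g = M -> val h = N ->
  preserves M O -> preserves N O -> commute (pg g) (pg h) -> M *m N = N *m M.
Proof.
move=> <- <- gO hO; rewrite /commute !pgM => /eq_PGLP[s s0 /= e].
have comp x y : preserves x O -> preserves y O -> preserves (x *m y) O.
  by move=> xO yO v Ov; rewrite -mulmxA; apply: xO; exact: yO.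
apply/esym; apply: (@proportional_det _ _ _ f c _ _ s HO _ _ _ e).
- exact: comp.
- exact: comp.
- by rewrite unitmx_mul !Defs.GL_unit.
- by rewrite !det_mulmx mulrC.
Qed.

Variable Gamma : set (PGL R d).
Hypotheses (Gsub : is_subgroup Gamma) (GAut : Gamma `<=` proj_Aut Omega).
Local Notation G := (lifts Gamma).

Lemma lifts_unit M : G M -> M \in unitmx.
Proof. by case=> g _ <-; exact: Defs.GL_unit. Qed.

Lemma lifts_mul M N : G M -> G N -> G (M *m N).
Proof.
move=> [g [Gg gO] <-] [h [Gh hO] <-]; exists (GLM g h) => //; split.
  by rewrite -pgM; exact: subgroupM.
by move=> v Ov; rewrite /= -mulmxA; apply: gO; exact: hO.
Qed.

Lemma lifts_inv M : G M -> G (invmx M).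
Proof.
move=> [g [Gg gO] <-].
have GV : Gamma (pg (GLV g)) by rewrite -pgV; exact: subgroupV.
exists (GLV g) => //; split=> //; apply/preservesP; first exact: GAut.
move=> v Ov; rewrite lt_neqAle eq_sym lift_nz //=; last exact: GAut.
rewrite leNgt; apply/negP => fv.
have nw : - (invmx (val g) *m v) != 0.
  by apply/eqP => e; move/eqP: e; rewrite oppr_eq0 => /eqP e; rewrite e linear0 ltxx in fv.
have : O (- (invmx (val g) *m v)).
  rewrite -[- _]/(val (mknz nw)); apply/cone_overP; split; last by rewrite /= linearN oppr_gt0.
  case: Ov => w [Ow _] e.
  rewrite (@pi_scale _ _ (GLact (GLV g) w) _ (-1)) ?oppr_eq0 ?oner_eq0 //.
    by rewrite -pact_pi; apply/autE => //; exact: GAut.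
  by rewrite /= e scaleN1r.
move=> /gO/(poc_pos HO); rewrite mulmxN mulKVmx ?Defs.GL_unit // linearN oppr_gt0.
by have /(poc_pos HO) := Ov => /lt_trans h /h; rewrite ltxx.
Qed.

Lemma lifts_scal t : 0 < t -> G t%:M.
Proof.
move=> t0; have tu : (t%:M : 'M[R]_d) \in unitmx.
  by rewrite -scalemx1 unitmxZ ?unitmx1 // unitfE gt_eqF.
exists (mkGL tu) => //; split; last first.
  by move=> v Ov /=; rewrite mul_scalar_mx; exact: (pocZ HO).
rewrite (_ : pg _ = 1%g); first exact: subgroup1.
by rewrite -pg1; apply/esym/eq_PGLP; exists t; rewrite ?gt_eqF //= scalemx1.
Qed.

Lemma lifts_pres M : G M -> preserves M O.
Proof. by case=> g [_ gO] <-. Qed.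

Lemma lifts_discrete : discrete_subset Gamma -> exists2 e : R, 0 < e &
  forall M, G M -> `|M - 1%:M| <= e -> exists s, M = s%:M.
Proof.
move=> /(_ 1%g (subgroup1 Gsub)) [_ [B B1 BG]].
have : nbhs (GL1 R d) ((fun g : GL R d => pg g) @^-1` B).
  by apply: (@pi_continuous _ _ (GL1 R d)).
rewrite nbhsE /= => -[D' [[D oD DD'] D1] DB].
have /nbhs_closedballP[e eD] : nbhs (1%:M : 'M[R]_d) D.
  by apply: open_nbhs_nbhs; split=> //; move: D1; rewrite -DD'.
exists e%:num => // _ [g [Gg _] <-] ge.
have : (B `&` Gamma) (pg g).
  split=> //; apply: (DB g); rewrite -DD' /=; apply: eD.
  by rewrite closed_ballE // /closed_ball_ /= distrC.
rewrite BG /= -pg1 => /esym/eq_PGLP[s s0 e']; exists s.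
by rewrite e' /= scalemx1.
Qed.

End Lifts.

(** * The cone over the convex core *)

Section Core.
Variables (R : realType) (d : nat) (Omega : set (projspace R d)) (f : {scalar 'cV[R]_d}).
Local Notation E := 'cV[R]_d.
Local Notation pj w := (\pi_(projspace R d) w).
Local Notation pg g := (\pi_(PGL R d) g).
Hypotheses (Oopen : open Omega) (Ochart : in_chart f Omega).
Local Notation O := (cone_over f Omega).
Variable c : R.
Hypothesis HO : proper_open_cone O f c.
Local Notation K := (closure O).
Variable Gamma : set (PGL R d).
Hypotheses (Gsub : is_subgroup Gamma) (GAut : Gamma `<=` proj_Aut Omega).
Local Notation G := (lifts Omega f Gamma).
Local Notation L := (full_orbital_limit_set Omega Gamma).
Local Notation hull := (convex_hull_in (closure Omega) L).
Local Notation core := (convex_core Omega Gamma).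
Local Notation C := (cone_over f core).

Lemma closure_pact (g : PGL R d) X Y x : (forall y, X y -> Y (pact g y)) ->
  closure X x -> closure Y (pact g x).
Proof.
move=> XY Xx N /(pact_continuous (g := g)) /Xx[y [Xy Ny]].
by exists (pact g y); split=> //; exact: XY.
Qed.

Lemma closure_pactE (g : PGL R d) x : Gamma g ->
  closure Omega (pact g x) <-> closure Omega x.
Proof.
move=> Gg; split=> [|]; last by apply: closure_pact => y Oy; apply/autE => //; exact: GAut.
move=> Ox; rewrite -[x]pact1 -(mulVg g) pactM; apply: closure_pact Ox => y Oy.
by apply/autE => //; apply: GAut; exact: subgroupV.
Qed.

Lemma limit_set_pact g x : Gamma g -> L x -> L (pact g x).
Proof.
move=> Gg [[clx nx] [p Op [h hG hx]]]; split.
  split; first by apply/closure_pactE.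
  move: nx; rewrite ((@interior_id _ Omega).1 Oopen) => nx gx; apply: nx.
  by apply/(autE (g := g)) => //; exact: GAut.
exists p => //; exists (fun n => (g * h n)%g); first by move=> n; exact: subgroupM.
under eq_fun do rewrite pactM.
by apply: (cvg_comp _ _ hx); exact: pact_continuous.
Qed.

Lemma proj_convex_preimage (g : PGL R d) X : proj_convex X -> proj_convex [set x | X (pact g x)].
Proof.
move=> [h [[v hv] Xh /convex_setP Xc]]; rewrite -[g]reprK; set M := repr g.
exists (h \o mulmx (val M)); split.
- by exists (invmx (val M) *m v); rewrite /= mulKVmx ?Defs.GL_unit.
- by move=> w /=; rewrite pact_pi => /Xh.
apply/convex_setP => x y t [w1 [/= X1 h1] <-] [w2 [/= X2 h2] <-] t0 t1.
rewrite pact_pi in X1; rewrite pact_pi in X2.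
have [w [Xw hw] we] := Xc (val M *m val w1) (val M *m val w2) t
  (ex_intro2 _ _ (GLact M w1) (conj X1 h1) erefl)
  (ex_intro2 _ _ (GLact M w2) (conj X2 h2) erefl) t0 t1.
have e : val M *m (t *: val w1 + (1 - t) *: val w2) = val w.
  by rewrite we mulmxDr -!scalemxAr.
have nz : t *: val w1 + (1 - t) *: val w2 != 0.
  by apply/eqP => z; move: e (nzvec_neq0 w); rewrite z mulmx0 => <-; rewrite eqxx.
exists (mknz nz) => //; split; rewrite /= ?pact_pi; last by rewrite e.
by rewrite (_ : GLact _ _ = w) //; apply: val_inj.
Qed.

Lemma hull_pact g x : Gamma g -> hull x -> hull (pact g x).
Proof.
move=> Gg Hx X [Xc LX XO]; apply: (Hx [set x | X (pact g x)]); split.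
- exact: proj_convex_preimage.
- by move=> y Ly; apply: LX; exact: limit_set_pact.
- by move=> y /XO; apply: (closure_pactE _ Gg).1.
Qed.

Lemma core_pact g x : Gamma g -> core x -> core (pact g x).
Proof.
by move=> Gg [Hx Ox]; split; [exact: hull_pact|apply/autE => //; exact: GAut].
Qed.

Lemma hull_add w1 w2 w3 : K (val w1) -> K (val w2) -> hull (pj w1) -> hull (pj w2) ->
  val w3 = val w1 + val w2 -> hull (pj w3).
Proof.
move=> K1 K2 H1 H2 e X XX; have [Xc LX XO] := XX.
exact: (proj_convex_add Ochart HO Xc XO K1 K2 (H1 X XX) (H2 X XX) e).
Qed.

Lemma core_cone_sub : C `<=` O.
Proof. by move=> _ [w [[_ Ow] fw] <-]; apply/cone_overP. Qed.

Lemma core_cone_pres M : G M -> preserves M C.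
Proof.
move=> [g [Gg gO] <-] _ [w [Cw fw] <-]; have [_ Ow] := Cw.
have /gO/(poc_pos HO) fgw : O (val w) by apply/cone_overP.
rewrite -[_ *m _]/(val (GLact g w)); apply/cone_overP; split=> //.
by rewrite -pact_pi; exact: core_pact.
Qed.

(** The direction of v is in the limit set, hence in the hull; adding to v a
    small multiple of a vector over the core stays in the hull and enters O. *)
Lemma core_cone_limit w v : O w -> ~ O v -> v != 0 ->
  (forall e, 0 < e -> exists2 g, G g & `|g *m w - v| <= e) ->
  core !=set0 -> closure C v.
Proof.
move=> Ow nOv v0 lim [x0 Cx0].
have Kv : K v.
  apply/closureP => e /lim[g Gg gv]; exists (g *m w); last by rewrite distrC.
  exact: (lifts_pres Gg).
pose v' := mknz v0.
have Lv : L (pj v').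
  split.
    split; first exact: (closure_cone_over (w := v') Kv).
    rewrite ((@interior_id _ Omega).1 Oopen) => Ov.
    have [//|nO] := in_chart_sign Ochart Ov.
    have := poc_pos HO nO; rewrite linearN oppr_gt0.
    by have := Kf_ge0 HO Kv => /le_lt_trans h /h; rewrite ltxx.
  have ex n : exists g : GL R d, [/\ Gamma (pg g) & `|val g *m w - v| <= n.+1%:R^-1].
    have [|_ [g [Gg _] <-] gv] := lim n.+1%:R^-1; first by rewrite invr_gt0.
    by exists g.
  have [g gP] := choice ex.
  case: Ow {lim ex} g gP => w' [Ow' fw'] <- g gP.
  exists (pj w') => //; exists (fun n => pg (g n)) => [n|]; first by case: (gP n).
  move=> N /nbhs_proj[e e0 eN]; rewrite /= nbhs_filterE.
  have /cvgrPdist_le/(_ e e0) := @cvg_harmonic R.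
  apply: filterS => n; rewrite sub0r normrN gtr0_norm ?invr_gt0 ?ltr0n // => ne.
  rewrite /= pact_pi; apply: eN; rewrite /= distrC.
  by apply: le_trans ne; case: (gP n).
have Hv : hull (pj v') by move=> X [_ LX _]; exact: LX.
have [u0 [Cu0 fu0]] : exists u0, core (pj u0) /\ 0 < f (val u0).
  have [_ Ox0] := Cx0; rewrite -[x0]reprK in Ox0 Cx0.
  have [/cone_overP[_ fx]|[w' [Ow' fw'] e]] := in_chart_sign Ochart Ox0.
    by exists (repr x0).
  exists w'; split=> //; rewrite (@pi_scale _ _ (repr x0) _ (-1)) ?oppr_eq0 ?oner_eq0 //.
  by rewrite e scaleN1r.
have Ou0 : O (val u0) by apply/cone_overP; split=> //; case: Cu0.
apply/closureP => e e0.
have n0 : 0 < 1 + `|val u0| by rewrite ltr_pwDl.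
pose t := e / (1 + `|val u0|); have t0 : 0 < t by rewrite divr_gt0.
have Otu : O (t *: val u0) by exact: (pocZ HO).
have Ovt : O (t *: val u0 + v) by exact: (pocDK HO).
exists (t *: val u0 + v); last first.
  rewrite opprD addrCA subrr addr0 normrN normrZ gtr0_norm // /t mulrAC ler_pdivrMr //.
  by rewrite ler_pM2l // lerDr.
case: Otu => u1 [Ou1 fu1] e1; rewrite -e1 in Ovt *.
case: Ovt => u2 [Ou2 fu2] e2; rewrite -e2.
apply/cone_overP; split=> //; split=> //.
apply: (@hull_add u1 v' u2) => //.
  by apply: poc_subK; apply/cone_overP.
rewrite (@pi_scale _ _ u0 u1 t) ?gt_eqF //.
by case: Cu0.
Qed.

(** Take for k a lift of a cluster point of the classes of the x n.  The union
    of the orbits that meet a neighbourhood of the direction of k is open in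
    the quotient, so it contains the classes of infinitely many x n. *)
Lemma core_cone_cocompact : compact_quotient Gamma core ->
  forall x : nat -> E, (forall n, C (x n)) ->
    exists2 k, C k & forall e, 0 < e -> forall N, exists2 n, (N <= n)%N &
      exists2 g, G g & `|g *m x n - k| <= e.
Proof.
move=> cpt x Cx.
have ex n : exists w : nzvec R d, [/\ val w = x n, core (pj w) & 0 < f (val w)].
  by have [w [Cw fw] e] := Cx n; exists w.
pose w n := sval (cid (ex n)).
have wP n : [/\ val (w n) = x n, core (pj (w n)) & 0 < f (val (w n))].
  by rewrite /w; case: cid.
pose y n : core := exist _ (pj (w n)) (mem_set (let: And3 _ p _ := wP n in p)).
pose orb (z : core) : orbit_space Gamma core := \pi_(orbit_space Gamma core) z.
have [|q [_ qP]] := cpt (orb (y n) @[n --> \oo]) _; first exact: filterT.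
pose k0 : core := repr q.
have Ck0 : core (val k0) by exact: set_mem (valP k0).
have [k [Ck fk ke]] : exists k : nzvec R d, [/\ core (pj k), 0 < f (val k) & pj k = val k0].
  have [_ Ok0] := Ck0; rewrite -[val k0]reprK in Ok0 *.
  have [/cone_overP[_ fx]|[w' [Ow' fw'] e]] := in_chart_sign Ochart Ok0.
    by exists (repr (val k0)); split=> //; rewrite reprK.
  have e' : pj w' = pj (repr (val k0)).
    rewrite (@pi_scale _ _ (repr (val k0)) _ (-1)) ?oppr_eq0 ?oner_eq0 //.
    by rewrite e scaleN1r.
  by exists w'; split=> //; rewrite e' reprK.
exists (val k); first by apply/cone_overP.
move=> e e0 N.
have Ok : O (val k) by apply: core_cone_sub; apply/cone_overP.
pose D := O `&` ball (val k) e.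
have oD : open D by apply: openI; [exact: (poc_open HO)|exact: ball_open].
pose PD := [set pj w | w in [set w : nzvec R d | D (val w)]].
have oPD : open PD by exact: proj_open.
pose B := [set z : orbit_space Gamma core | exists2 g, Gamma g & PD (pact g (val (repr z)))].
have BE (z : core) : B (orb z) <-> exists2 g, Gamma g & PD (pact g (val z)).
  have : same_orbit Gamma (repr (orb z)) z by apply/eqmodP; rewrite reprK.
  move=> /(same_orbitP _ _ Gsub)[h Gh hz].
  split=> [[g Gg gz]|[g Gg gz]].
    exists (g * h^-1)%g; first by apply: subgroupM => //; exact: subgroupV.
    by rewrite -hz -pactM -mulgA mulVg mulg1.
  by exists (g * h)%g; [exact: subgroupM|rewrite pactM hz].
have oB : open B.
  rewrite /open /= /quotient_open /=.
  rewrite (_ : _ @^-1` B = \bigcup_(g in Gamma) (val @^-1` (pact g @^-1` PD))).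
    apply: bigcup_open => g Gg.
    exists (pact g @^-1` PD) => //.
    by apply: open_comp => // ? _; exact: pact_continuous.
  apply/seteqP; split=> [z /BE[g Gg gz]|z [g Gg gz]]; first by exists g.
  by apply/BE; exists g.
have Bq : B q.
  exists 1%g; first exact: subgroup1.
  rewrite pact1 -/k0 -ke; exists k => //; split=> //; exact: ballxx.
have F1 : (orb (y n) @[n --> \oo]) (orb @` (y @` [set n | (N <= n)%N])).
  by exists N => // n /= Nn; exists (y n) => //; exists n.
have [_ [[_ [n Nn <-] <-] /BE[g Gg [w' [Ow' kw'] e']]]] :=
  qP _ _ F1 (open_nbhs_nbhs (conj oB Bq)).
exists n => //; have [wE _ fw] := wP n.
have [h hg hO] := lift_exists Ochart HO (GAut Gg).
have e2 : pj w' = pj (GLact h (w n)) by rewrite e' -hg pact_pi.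
have /eq_projP[s s0 se] := e2.
have Ox : O (x n) by exact: core_cone_sub.
have fw' := poc_pos HO Ow'.
have : 0 < f (val (GLact h (w n))) by rewrite /= wE; exact: (poc_pos HO (hO _ Ox)).
rewrite se linearZ /= pmulr_lgt0 // => s0'.
exists (s^-1%:M *m val h).
  apply: (lifts_mul Gsub); first by apply: (lifts_scal HO Gsub); rewrite invr_gt0.
  by exists h => //; split=> //; rewrite hg.
rewrite mul_scalar_mx -scalemxAl -wE -[val h *m _]/(val (GLact h (w n))) se scalerA.
rewrite mulVf // scale1r distrC ltW //.
by rewrite -ball_normE in kw'.
Qed.

Lemma core_cocompact_cone : convex_cocompact Omega Gamma ->
  cocompact_cone O f c G C.
Proof.
move=> [_ disc C0 cpt]; split=> //.
- exact: lifts_unit.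
- exact: lifts_mul.
- by move=> g; exact: (lifts_inv Ochart HO Gsub GAut).
- by move=> t; exact: (lifts_scal HO Gsub).
- exact: lifts_pres.
- exact: (@lifts_discrete R d Omega f Gamma Gsub disc).
- exact: core_cone_sub.
- have [x Cx] := C0; have [_ Ox] := Cx; rewrite -[x]reprK in Cx Ox.
  have [/cone_overP[_ fx]|[w' [Ow' fw'] e]] := in_chart_sign Ochart Ox.
    by exists (val (repr x)); apply/cone_overP.
  exists (val w'); apply/cone_overP; split=> //.
  rewrite (@pi_scale _ _ (repr x) _ (-1)) ?oppr_eq0 ?oner_eq0 //.
  by rewrite e scaleN1r.
- move=> u v Cu Cv; have := pocD HO (core_cone_sub Cu) (core_cone_sub Cv).
  case: Cu => w1 [C1 f1] <-; case: Cv => w2 [C2 f2] <-; move=> [w [Ow fw] e].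
  rewrite -e; apply/cone_overP; split=> //; split=> //.
  have [H1 O1] := C1; have [H2 O2] := C2.
  by apply: (@hull_add w1 w2 w) => //; apply: poc_subK; apply/cone_overP.
- by move=> t v; exact: cone_over_scale.
- exact: core_cone_pres.
- exact: core_cone_cocompact.
- by move=> w v Ow nOv v0 lim; exact: (core_cone_limit Ow).
Qed.

End Core.

(** * Fixed directions and the centralizer in projective space *)

Section FixedSpan.
Variables (R : realType) (d : nat) (Omega : set (projspace R d)) (f : {scalar 'cV[R]_d}).
Local Notation E := 'cV[R]_d.
Local Notation pj w := (\pi_(projspace R d) w).
Local Notation pg g := (\pi_(PGL R d) g).
Hypotheses (Ochart : in_chart f Omega).
Local Notation O := (cone_over f Omega).
Variable c : R.
Hypothesis HO : proper_open_cone O f c.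
Local Notation K := (closure O).
Variables (Gamma A : set (PGL R d)).
Hypotheses (Gsub : is_subgroup Gamma) (GAut : Gamma `<=` proj_Aut Omega).
Hypotheses (AG : A `<=` Gamma) (Aab : is_abelian A) (Ainf : infinite_set A).
Local Notation core := (convex_core Omega Gamma).
Local Notation C := (cone_over f core).
Local Notation GL_ := (lifts Omega f Gamma).
Local Notation AL := (lifts Omega f A).

Lemma lifts_sub : AL `<=` GL_.
Proof. by move=> _ [g [Ag gO] <-]; exists g => //; split=> //; exact: AG. Qed.

Lemma lifts_abelian a b : AL a -> AL b -> a *m b = b *m a.
Proof.
move=> [g [Ag gO] ge] [h [Ah hO] he].
apply: (lifts_commute HO ge he); rewrite -?ge -?he //.
by apply: Aab; rewrite inE.
Qed.

Lemma infinite_sequence (T : Type) (B : set T) : infinite_set B ->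
  exists u : nat -> T, (forall n, B (u n)) /\ injective u.
Proof.
move=> /infiniteP/card_leP[u].
exists (fun n => val (u (exist _ n (mem_set (I : [set: nat] n))))); split=> [n|n m].
  exact: set_mem (valP _).
move=> /val_inj e; have := @inj _ _ _ u _ _ (mem_set I) (mem_set I) e.
by move=> /(congr1 val).
Qed.

Lemma lifts_infinite : exists a : nat -> 'M[R]_d, (forall n, AL (a n)) /\
  forall n m s, a n = s *: a m -> n = m.
Proof.
have [u [Au u_inj]] := infinite_sequence Ainf.
have ex n : exists g : GL R d, pg g = u n /\ preserves (val g) O.
  by have [g ? ?] := lift_exists Ochart HO (GAut (AG (Au n))); exists g.
have [g gP] := choice ex.
exists (fun n => val (g n)); split=> [n|n m s e].
  by exists (g n) => //; case: (gP n) => gn gO; split=> //; rewrite gn.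
apply: u_inj; rewrite -(gP n).1 -(gP m).1; apply/esym/eq_PGLP; exists s => //.
apply/eqP => s0; have [ o Oo] := poc_neq0 HO.
by have := poc_pos HO ((gP n).2 _ Oo); rewrite e s0 scale0r mul0mx linear0 ltxx.
Qed.

Lemma fixed_span_of_vectors (e : E) : fixed_vector C AL e -> e \in fixed_span Omega Gamma A.
Proof.
move=> [Ce e0 ae]; apply/linear_spanP; exists [:: e]; last by rewrite memv_span ?mem_head.
move=> u; rewrite inE => /eqP ->.
exists (mknz e0) => //; split; first exact: (closure_cone_over (w := mknz e0) Ce).
move=> a Aa; have [g ga gO] := lift_exists Ochart HO (GAut (AG Aa)).
have [l al] : exists l, val g *m e = l *: e.
  by apply: ae; exists g => //; split=> //; rewrite ga.
rewrite -ga pact_pi; apply: (@pi_scale _ _ (mknz e0) _ l) => //.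
apply/eqP => l0; move/eqP: e0; apply.
by rewrite -[e](mulKmx (Defs.GL_unit g)) al l0 scale0r mulmx0.
Qed.

Lemma fixed_vectors_span (V : {vspace E}) :
  (forall e, fixed_vector C AL e -> e \in V) -> (fixed_span Omega Gamma A <= V)%VS.
Proof.
move=> FV; apply/subvP => v /linear_spanP[s sS].
suff : (span s <= V)%VS by move=> /subvP; apply.
apply/span_subvP => _ /sS[w [clw aw] <-].
have core_chart : in_chart f core by move=> w' [_ Ow']; exact: Ochart.
have eig (a : 'M[R]_d) : AL a -> exists l, a *m val w = l *: val w.
  move=> [g [Ag gO] <-]; have := aw _ Ag; rewrite pact_pi => /eq_projP[l l0 e].
  by exists l^-1; rewrite [in RHS]e scalerA mulVf // scale1r.
have [Cw|Cw] := closure_lift core_chart clw.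
  by apply: FV; split; [exact: Cw|exact: nzvec_neq0|exact: eig].
rewrite -memvN; apply: FV; split; [exact: Cw|by rewrite oppr_eq0 nzvec_neq0|].
by move=> a /eig[l al]; exists l; rewrite mulmxN al scalerN.
Qed.

Lemma centralizer_lift g : centralizer_in Gamma A g ->
  exists M : GL R d, pg M = g /\ centralizer GL_ AL (val M).
Proof.
move=> [Gg gA]; have [M Mg MO] := lift_exists Ochart HO (GAut Gg).
exists M; split=> //; split; first by exists M => //; split=> //; rewrite Mg.
move=> _ [h [Ah hO] <-]; apply: (lifts_commute HO erefl erefl) => //.
by rewrite Mg; exact: gA.
Qed.

Lemma centralizer_proj (M : GL R d) : centralizer GL_ AL (val M) -> centralizer_in Gamma A (pg M).
Proof.
move=> [[g [Gg gO] gM] MA]; have gME : g = M by exact: val_inj.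
rewrite gME in Gg; split=> // k Ak.
have [h hk hO] := lift_exists Ochart HO (GAut (AG Ak)).
rewrite -hk /commute !pgM; congr (pg _); apply: val_inj => /=.
by apply: MA; exists h => //; split=> //; rewrite hk.
Qed.

Lemma proj_subspaceP (V : {vspace E}) w : proj_subspace V (pj w) <-> val w \in V.
Proof.
split=> [[w' wV /eq_projP[s s0 ->]]|wV]; last by exists w.
exact: memvZ.
Qed.

End FixedSpan.

Theorem theorem1p4 (R : realType) (d : nat)
    (Omega : set (projspace R d)) (Gamma A : set (PGL R d)) :
  properly_convex_domain Omega ->
  is_subgroup Gamma -> Gamma `<=` proj_Aut Omega -> convex_cocompact Omega Gamma ->
  is_subgroup A -> A `<=` Gamma -> is_abelian A -> infinite_set A ->
  let V := fixed_span Omega Gamma A in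
  let Z := centralizer_in Gamma A in
  let X := Omega `&` proj_subspace V in
  [/\ X !=set0,
      forall g, Z g -> pact g @` X = X,
      properly_convex_domain_in V X &
      compact_quotient Z X].
Proof.
move=> [[Om oOm OmE] [f [_ Ochart Oconv Obd]]] Gsub GAut cc Asub AG Aab Ainf V Z X.
have Oopen : open Omega.
  rewrite OmE (_ : proj_subspace fullv = setT) ?setIT //.
  by apply/seteqP; split=> // x _; rewrite -[x]reprK; apply/proj_subspaceP; exact: memvf.
have Oneq0 : Omega !=set0 by case: cc => _ _ [x [_ Ox]] _; exists x.
have [c HO] := domain_proper_cone Oopen Ochart Oconv Obd Oneq0.
pose G := lifts Omega f Gamma; pose AL := lifts Omega f A.
pose C := cone_over f (convex_core Omega Gamma); pose O := cone_over f Omega.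
have H : cocompact_cone O f c G C by exact: core_cocompact_cone.
have ALG : AL `<=` G by exact: lifts_sub.
have ALcomm x y : AL x -> AL y -> x *m y = y *m x by exact: (lifts_abelian HO Aab).
have ALinf := lifts_infinite Ochart HO GAut AG Ainf.
have [s [sA sspan]] := spanning_seq AL.
pose a j := tnth (in_tuple s) j.
have Aa j : AL (a j) by apply: sA; exact: mem_tnth.
have Aspan (q : 'M[R]_d) : AL q -> exists k : 'I_(size s) -> R, q = \sum_j k j *: a j.
  move=> /sspan qs; have qE := @coord_span _ _ _ (in_tuple s) q qs; exists (fun j => coord (in_tuple s) j q).
  by rewrite {1}qE; apply: eq_bigr => j _; rewrite /a (tnth_nth 0).
have [t [tF tspan]] := spanning_seq (fixed_vector C AL).
pose b := in_tuple t.
have bF i : fixed_vector C AL (tnth b i) by apply: tF; exact: mem_tnth.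
have VE : V = span b.
  apply/eqP; rewrite eqEsubv; apply/andP; split.
    exact: (fixed_vectors_span Ochart).
  by apply/span_subvP => u /tF; exact: (fixed_span_of_vectors Ochart HO GAut AG).
have ZV (z : 'M[R]_d) v : centralizer G AL z -> v \in V -> z *m v \in V.
  by rewrite VE => Zz vV; apply: (centralizer_span H bF).
pose chi i j := sval (cid ((let: And3 _ _ e := bF i in e) (a j) (Aa j))).
have bchi i j : a j *m tnth b i = chi i j *: tnth b i by rewrite /chi; case: cid.
have ZX g x : Z g -> X x -> X (pact g x).
  move=> Zg [Ox Vx]; split; first by apply/autE => //; apply: GAut; case: Zg.
  have [M [<- ZM]] := centralizer_lift Ochart HO GAut Zg.
  move: Vx; rewrite -[x]reprK => /proj_subspaceP xV.
  by rewrite pact_pi; apply/proj_subspaceP; exact: ZV.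
have Zsub : is_subgroup Z.
  split; first by rewrite inE; split=> [|k _]; [exact: subgroup1|rewrite /commute mul1g mulg1].
  move=> g h /set_mem[Gg gA] /set_mem[Gh hA]; apply: mem_set; split.
    by apply: subgroupM => //; exact: subgroupV.
  move=> k Ak; apply: commute_sym; apply: commuteM; first exact: commute_sym (gA _ Ak).
  by apply: commuteV; exact: commute_sym (hA _ Ak).
have lift_vec x : X x -> exists w : nzvec R d, [/\ \pi_(projspace R d) w = x, val w \in V & O (val w)].
  rewrite -[x]reprK => -[Ox /proj_subspaceP xV].
  have [Ow|[w Ow we]] := in_chart_sign Ochart Ox; first by exists (repr x).
  exists w; split; last by apply/cone_overP.
    rewrite (@pi_scale _ _ (repr x) _ (-1)) ?oppr_eq0 ?oner_eq0 //.
    by rewrite we scaleN1r.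
  by rewrite we memvN.
have [v [vV Cv]] : exists v, v \in V /\ C v.
  by rewrite VE; apply: (fixed_span_meets H ALG ALcomm Aa Aspan bF tspan).
have Ov : O v by exact: (C_sub H).
split.
- case: Ov vV => w [Ow fw] <- vV; exists (\pi_(projspace R d) w); split=> //.
  exact/proj_subspaceP.
- move=> g Zg; apply/seteqP; split=> [_ [x Xx <-]|x Xx]; first exact: ZX.
  exists (pact g^-1%g x); first by apply: ZX => //; exact: subgroupV.
  by rewrite -pactM mulgV pact1.
- split; first by exists Omega.
  exists f; split.
  + by exists v => //; rewrite gt_eqF // (poc_pos HO).
  + by move=> w [Ow _]; exact: Ochart.
  + apply/convex_setP => x y k [w1 [[p1 V1] f1] <-] [w2 [[p2 V2] f2] <-] k0 k1.
    have [||w [Ow fw] we] := (convex_setP _).1 Oconv (val w1) (val w2) k _ _ k0 k1.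
    * by exists w1.
    * by exists w2.
    exists w => //; split=> //; split=> //; apply/proj_subspaceP; rewrite we.
    by apply: rpredD; apply: memvZ; exact/proj_subspaceP.
  + have [M [Mr MP]] := Obd; exists M; split=> // q Mq x [w [[Ow Vw] fw] <-].
    by apply: MP => //; exists w.
(* Choose a vector over each orbit.  Along an ultrafilter of the quotient,
   elements of the centralizer make these vectors converge, and this does not
   change their orbits. *)
rewrite /compact_quotient compact_ultra => F UF _.
pose I := orbit_space Z X.
have XI (i : I) : X (val (repr i)) by exact: set_mem (valP (repr i)).
have [w wP] := choice (fun i : I => lift_vec _ (XI i)).
have [z zZ [k [kV Ok] zk]] : exists2 z : I -> 'M[R]_d, (forall i, centralizer G AL (z i)) &
    exists2 k, k \in V /\ O k & z i *m val (w i) @[i --> F] --> k.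
  rewrite VE; apply: (centralizer_cocompact_span H ALG ALinf Aa Aspan bF tspan bchi).
  - by move=> i; rewrite -VE; case: (wP i).
  - by move=> i; case: (wP i).
have zG i : exists g : GL R d, val g = z i by have [[g _ ge] _] := zZ i; exists g.
have [g gz] := choice zG.
have Zg i : Z (\pi_(PGL R d) (g i)) by apply: (centralizer_proj Ochart HO GAut AG); rewrite gz.
have [u [Ou fu] ue] := Ok.
have Xu : X (\pi_(projspace R d) u) by split=> //; apply/proj_subspaceP; rewrite ue.
pose y i : X := exist (fun x => x \in X) _ (mem_set (ZX _ _ (Zg i) (XI i))).
pose orb (x : X) : I := \pi_(orbit_space Z X) x.
have orb_y i : orb (y i) = i.
  rewrite -[RHS]reprK; apply/eqmodP/(same_orbitP _ _ Zsub).
  exists (\pi_(PGL R d) (g i))^-1%g; first exact: subgroupV.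
  by rewrite /= -pactM mulVg pact1.
pose yu : X := exist (fun x => x \in X) _ (mem_set Xu).
exists (orb yu); split=> // N.
move=> /(@pi_continuous _ _ yu); rewrite /= nbhs_filterE nbhsE /= => -[B [[D oD DB] Byu] BN].
have : nbhs (\pi_(projspace R d) u) D.
  by apply: open_nbhs_nbhs; split=> //; have : (val @^-1` D) yu by rewrite DB.
move=> /nbhs_proj[e e0 eD].
move: zk; rewrite -ue => /cvgrPdist_le/(_ e e0).
apply: filterS => i zi; rewrite -(orb_y i); apply: (BN (y i)).
have yE : \val (y i) = \pi_(projspace R d) (GLact (g i) (w i)).
  by have [e1 _ _] := wP i; rewrite -pact_pi e1.
have Dy : D (\val (y i)) by rewrite yE; apply: eD; rewrite /= gz.
by rewrite -DB; exact: Dy.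
Qed.
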